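(* Let $w\in\mathbb{F}$. The bounded linear weighted backward shift operator \[ X\ni x:=(x_k)_{k\in\mathbb{N}}\mapsto A_wx:=w\,(x_{k+1})_{k\in\mathbb{N}}\in X \] on the space $(X,\|\cdot\|)$ is (1) nonhypercyclic (i.e., not hypercyclic) for $|w|<1$, (2) hypercyclic but not chaotic for $|w|=1$, and (3) chaotic along with every power $A_w^n$, $n\in\mathbb{N}$, for $|w|>1$. Provided the space $(X,\|\cdot\|)$ is complex (i.e., $\mathbb{F}=\mathbb{C}$), \[ \sigma(A_w)=\{\lambda\in\mathbb{C}\mid |\lambda|\le|w|\} \] with \[ \sigma_p(A_w)=\{\lambda\in\mathbb{C}\mid|\lambda|<|w|\}\cup\{w\}\quad\text{and}\quad \sigma_c(A_w)=\{\lambda\in\mathbb{C}\mid|\lambda|=|w|\}\setminus\{w\}. \]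
   Context: $\mathbb{F}:=\mathbb{R}$ or $\mathbb{F}:=\mathbb{C}$; $\mathbb{N}=\{1,2,3,\dots\}$, $\mathbb{Z}_+=\{0,1,2,\dots\}$. $X$ is the separable infinite-dimensional Banach space over $\mathbb{F}$ \[ X:=\Big\{(x_k)_{k\in\mathbb{N}}\in\mathbb{F}^{\mathbb{N}}\ \Big|\ \sum_{k=1}^\infty\Big|\frac{x_{k+1}}{k+1}-\frac{x_k}{k}\Big|<\infty\ \text{and}\ \lim_{k\to\infty}\frac{x_k}{k}=0\Big\} \] with the norm $\|x\|:=\sum_{k=1}^\infty\left|\frac{x_{k+1}}{k+1}-\frac{x_k}{k}\right|$. For a (bounded or unbounded) linear operator $A$ in a (real or complex) Banach space $E$ with domain $D(A)$, let $A^0:=I$ and $C^\infty(A):=\bigcap_{n=0}^\infty D(A^n)$. A nonzero vector $x\in C^\infty(A)$ is hypercyclic for $A$ if its orbit $\{A^nx\}_{n\in\mathbb{Z}_+}$ is dense in $E$; $A$ is hypercyclic if it has a hypercyclic vector. A vector $x\in D(A^N)$ with $A^Nx=x$ for some $N\in\mathbb{N}$ is a periodic point of $A$. $A$ is chaotic if it is hypercyclic and its set of periodic points is dense in $E$. For a closed linear operator $A$ in a complex Banach space $E$, the spectrum $\sigma(A)$ is the disjoint union of the point spectrum $\sigma_p(A)=\{\lambda\in\mathbb{C}\mid A-\lambda I\text{ is not injective}\}$, the continuous spectrum $\sigma_c(A)=\{\lambda\in\mathbb{C}\mid A-\lambda I\text{ is injective, not surjective, and has dense range}\}$, and the residual spectrum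 $\sigma_r(A)=\{\lambda\in\mathbb{C}\mid A-\lambda I\text{ is injective and its range is not dense}\}$. *)

(* Defs.v *)
From HB Require Import structures.
From mathcomp Require Import all_boot all_order all_algebra.
From mathcomp Require Import complex ring.
From mathcomp Require Import mathcomp_extra boolp classical_sets functions.
From mathcomp Require Import reals topology normedtype sequences.

Set Implicit Arguments.
Unset Strict Implicit.
Unset Printing Implicit Defensive.

Import Order.TTheory GRing.Theory Num.Theory.
Import numFieldNormedType.Exports.

Local Open Scope classical_set_scope.
Local Open Scope complex_scope.
Local Open Scope ring_scope.

Variant scalar_kind := RealScalars | ComplexScalars.

Definition scalars (R : realType) (k : scalar_kind) : numFieldType :=
  match k with RealScalars => R | ComplexScalars => R[i] end.

Section NumFieldSeries.
Variable K : numFieldType.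
Implicit Types (u v : nat -> K) (l M : K).

Lemma cvg_lim_le T (F : set_system T) {FF : ProperFilter F} (f : T -> K) l M :
  f @ F --> l -> (\forall t \near F, f t <= M) -> l <= M.
Proof.
move=> fl fM; rewrite -subr_ge0.
have gl : (fun t => M - f t) @ F --> M - l.
  by apply: cvgB => //; exact: cvg_cst.
have ngl : (fun t => `|M - f t|) @ F --> `|M - l| by exact: cvg_norm.
have ngl' : (fun t => `|M - f t|) @ F --> M - l.
  apply: cvg_trans gl; apply: near_eq_cvg; apply: filterS fM => t ft.
  by rewrite ger0_norm// subr_ge0.
rewrite -(cvg_lim (@norm_hausdorff _ K^o) ngl').
by rewrite (cvg_lim (@norm_hausdorff _ K^o) ngl).
Qed.

Lemma cvgn_lim_ge0 u l : u @ \oo --> l -> (forall n, 0 <= u n) -> 0 <= l.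
Proof.
move=> ul u0; rewrite -oppr_le0.
apply: (@cvg_lim_le _ \oo _ (fun n => - u n) (- l)); first by apply: cvgN; exact: ul.
by apply: nearW => n; rewrite oppr_le0.
Qed.

Lemma series_le_lim u n : (forall i, 0 <= u i) -> cvgn (series u) ->
  series u n <= limn (series u).
Proof.
move=> u0 cu; rewrite -subr_ge0.
apply: (@cvgn_lim_ge0 (fun m => series u (m + n)%N - series u n)); last first.
  move=> m; rewrite subr_ge0 /series /= [leRHS](big_cat_nat (n := n)) ?leq_addl//=.
  by rewrite lerDl sumr_ge0.
apply: cvgB; last exact: cvg_cst.
by rewrite (cvg_shiftn n (series u)).
Qed.

End NumFieldSeries.

Section Scalars.
Variables (R : realType).

Lemma scalars_cauchy_cvg k (F : set_system (scalars R k)) :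
  ProperFilter F -> cauchy F -> cvg F.
Proof.
case: k F => /=; first by move=> F; exact: R_complete.
move=> F FF /cauchyP cF.
have aux (f : R[i] -> R) : (forall x y, `|f x - f y|%:C <= `|x - y|) ->
    cvg (f @ F).
  move=> fl; apply: R_complete; apply/cauchy_exP => e e0.
  have e0' : (0 : R[i]) < e%:C by rewrite (ltcR 0 e).
  have [x Fx] := cF _ e0'; exists (f x).
  suff xy : ball x e%:C `<=` f @^-1` ball (f x) e by exact: (filterS xy Fx).
  move=> y xy; rewrite /preimage /ball /= -ltcR.
  by apply: (le_lt_trans (fl x y)); exact: xy.
have cRe : cvg ((@complex.Re R : R[i] -> R) @ F).
  by apply: aux => x y; rewrite -raddfB; exact: normc_ge_Re.
have cIm : cvg ((@complex.Im R : R[i] -> R) @ F).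
  apply: aux => -[a b] [c d] /=.
  have := normc_ge_Re (((a +i* b) - (c +i* d)) * 'i).
  rewrite ReiNIm normrM [`|'i|](_ : _ = 1) ?mulr1 ?normrN//.
  by rewrite normc_def /= expr0n expr1n add0r sqrtr1.
pose a := lim ((@complex.Re R : R[i] -> R) @ F); pose b := lim ((@complex.Im R : R[i] -> R) @ F).
apply: (@cvgP (scalars R ComplexScalars) _ (a +i* b)); apply/cvgrPdist_lt => /= e e0.
have /complex_realP[d ed] : e \is Num.real by exact: gtr0_real.
rewrite ed in e0 *; rewrite (ltcR 0 d) in e0.
have d2 : 0 < d / 2 by rewrite divr_gt0.
move/cvgrPdist_lt : cRe => /(_ _ d2) cRe; move/cvgrPdist_lt : cIm => /(_ _ d2) cIm.
have decomp z : (a +i* b) - z = (a - complex.Re z)%:C + 'i * (b - complex.Im z)%:C.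
  by case: z => c e'; simpc.
near=> z; rewrite decomp.
apply: le_lt_trans (ler_normD _ _) _.
rewrite normrM [`|'i|](_ : _ = 1) ?mul1r; last first.
  by rewrite normc_def /= expr0n expr1n add0r sqrtr1.
rewrite !normc_def /= !expr0n !addr0 !sqrtr_sqr -rmorphD/= ltcR (splitr d).
rewrite ltrD//; near: z; [exact: cRe|exact: cIm].
Unshelve. all: by end_near. Qed.

Lemma is_cvg_series_bounded k (u : nat -> scalars R k) M :
  (forall n, 0 <= u n) -> (forall n, series u n <= M) -> cvgn (series u).
Proof.
case: k u M => /= u M u0 uM.
  apply: nondecreasing_is_cvgn; first exact: nondecreasing_series.
  by exists M => _ [n _ <-].
have uR n : u n = (complex.Re (u n))%:C by rewrite RRe_real// ger0_real.
pose v n := complex.Re (u n).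
have su n : series u n = (series v n)%:C.
  by rewrite /series /= rmorph_sum; apply: eq_bigr => i _; exact: uR.
have cv : cvgn (series v).
  apply: nondecreasing_is_cvgn.
    by apply: nondecreasing_series => n _; rewrite -ler0c -uR.
  exists (complex.Re M) => _ [n _ <-].
  by have := uM n; rewrite su lecE /= => /andP[].
apply: (@cvgP (scalars R ComplexScalars) _ (limn (series v))%:C); apply/cvgrPdist_lt => /= e e0.
have /complex_realP[d ed] : e \is Num.real by exact: gtr0_real.
rewrite ed in e0 *; rewrite (ltcR 0 d) in e0.
move/cvgrPdist_lt : cv => /(_ _ e0); apply: filterS => n /=.
by rewrite su -rmorphB normc_def /= expr0n addr0 sqrtr_sqr ltcR.
Qed.

End Scalars.

(* Sequences are indexed from 0: [x i] stands for the term x_{i+1}, so that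
   [ratio x i] is x_{i+1}/(i+1). Norms take their values in the scalar field,
   so convergence of the series of nonnegative terms [variation x] says that
   its sum is finite. *)
Section SequenceSpace.
Variables (R : realType) (k : scalar_kind).
Notation K := (scalars R k).
Implicit Types (x y : nat -> K).

Definition ratio x : nat -> K := fun i => x i / i.+1%:R.

Definition variation x : nat -> K := fun i => `|ratio x i.+1 - ratio x i|.

Definition bv_seq : pred (nat -> K) := fun x =>
  `[< cvgn (series (variation x)) /\ ratio x @ \oo --> (0 : K) >].

Lemma bv_seqP x : reflect
  (cvgn (series (variation x)) /\ ratio x @ \oo --> (0 : K)) (x \in bv_seq).
Proof. exact: asboolP. Qed.

Lemma variation_ge0 x i : 0 <= variation x i.
Proof. exact: normr_ge0. Qed.

Lemma is_cvg_series_le (u v : nat -> K) : (forall i, 0 <= u i) ->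
  (forall i, u i <= v i) -> cvgn (series v) -> cvgn (series u).
Proof.
move=> u0 uv cv; apply: (@is_cvg_series_bounded _ _ _ (limn (series v))) => // n.
apply: (@le_trans _ _ (series v n)); first exact: ler_sum.
by apply: series_le_lim => // i; exact: le_trans (uv i).
Qed.

Lemma ratio_lin a x y i : ratio (a *: x + y) i = a * ratio x i + ratio y i.
Proof. by rewrite /ratio /= mulrDl mulrA. Qed.

Lemma variation_lin a x y i :
  variation (a *: x + y) i <= `|a| * variation x i + variation y i.
Proof.
rewrite /variation !ratio_lin -normrM.
by rewrite [X in `|X| <= _](_ : _ = a * (ratio x i.+1 - ratio x i) +
  (ratio y i.+1 - ratio y i)) ?ler_normD//; ring.
Qed.

Lemma bv_submod_closed : submod_closed bv_seq.
Proof.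
split.
  have r0 : ratio 0 = fun=> 0 by apply/funext => i; rewrite /ratio mul0r.
  apply/bv_seqP; split; last by rewrite r0; exact: cvg_cst.
  rewrite (_ : series _ = fun=> 0); first exact: is_cvg_cst.
  apply/funext => n; rewrite /series /= big1// => i _.
  by rewrite /variation r0 subrr normr0.
move=> a x y /bv_seqP[cx x0] /bv_seqP[cy y0]; apply/bv_seqP; split.
  apply: (@is_cvg_series_le _ (`|a| *: variation x + variation y)).
  - exact: variation_ge0.
  - exact: variation_lin.
  - apply: is_cvg_seriesD => //; exact: is_cvg_seriesZ.
rewrite (_ : ratio _ = (fun i => a * ratio x i + ratio y i)); last first.
  by apply/funext => i; exact: ratio_lin.
have ax : (fun i => a * ratio x i) @ \oo --> a * 0.
  by apply: cvgM => //; exact: cvg_cst.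
by rewrite -[0 in X in _ --> X]addr0 -[X in X + 0](mulr0 a); exact: cvgD.
Qed.

HB.instance Definition _ := GRing.isSubmodClosed.Build K (nat -> K) bv_seq
  bv_submod_closed.

Record bvspace := BVSpace { bvspace_seq :> nat -> K; _ : bv_seq bvspace_seq }.

HB.instance Definition _ := [isSub for bvspace_seq].
HB.instance Definition _ := [Choice of bvspace by <:].
HB.instance Definition _ := [SubChoice_isSubLmodule of bvspace by <:].

Lemma bv_series_cvg (x : bvspace) : cvgn (series (variation x)).
Proof. by case: x => x /= /bv_seqP[]. Qed.

Lemma bv_ratio_cvg0 (x : bvspace) : ratio x @ \oo --> (0 : K).
Proof. by case: x => x /= /bv_seqP[]. Qed.

Definition bvnorm (x : bvspace) : K := limn (series (variation x)).

Lemma series_le_bvnorm (x : bvspace) n : series (variation x) n <= bvnorm x.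
Proof. by apply: series_le_lim; [exact: variation_ge0|exact: bv_series_cvg]. Qed.

Lemma bvnorm_le (x : bvspace) M :
  (forall n, series (variation x) n <= M) -> bvnorm x <= M.
Proof.
move=> xM; apply: (@cvg_lim_le _ _ \oo _ (series (variation x))).
  exact: bv_series_cvg.
exact: nearW.
Qed.

Lemma ratio_le_bvnorm (x : bvspace) i : `|ratio x i| <= bvnorm x.
Proof.
have H : (fun n => `|ratio x i| - `|ratio x (n + i)%N|) @ \oo --> `|ratio x i| - `|0 : K|.
  apply: cvgB; first exact: cvg_cst.
  by apply: cvg_norm; rewrite (cvg_shiftn i (ratio x)); exact: bv_ratio_cvg0.
rewrite normr0 subr0 in H; apply: (cvg_lim_le H); apply: nearW => n.
apply: le_trans (lerB_dist _ _) _; rewrite distrC.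
rewrite -telescope_sumr ?leq_addl//.
apply: le_trans (ler_norm_sum _ _ _) _.
apply: le_trans (series_le_bvnorm x (n + i)).
rewrite /series /= [leRHS](big_cat_nat (n := i)) ?leq_addl//=.
by rewrite lerDr sumr_ge0// => j _; exact: variation_ge0.
Qed.

Lemma bvnormD (x y : bvspace) : bvnorm (x + y) <= bvnorm x + bvnorm y.
Proof.
apply: bvnorm_le => n; apply: le_trans (lerD (series_le_bvnorm x n) (series_le_bvnorm y n)).
rewrite /series /= -big_split /=; apply: ler_sum => i _.
by have := variation_lin 1 x y i; rewrite scale1r normr1 mul1r.
Qed.

Lemma bvnormZ (a : K) (x : bvspace) : bvnorm (a *: x) = `|a| * bvnorm x.
Proof.
have e : variation (a *: x) = `|a| *: variation x.
  apply/funext => i; have r j : ratio (a *: x) j = a * ratio x j.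
    by rewrite /ratio /= mulrA.
  by rewrite /variation !r -mulrBr normrM.
rewrite /bvnorm e seriesZ; apply: (cvg_lim (@norm_hausdorff _ K^o)).
by apply: cvgZ; [exact: cvg_cst|exact: bv_series_cvg].
Qed.

Lemma bvnorm0_eq0 (x : bvspace) : bvnorm x = 0 -> x = 0.
Proof.
move=> x0; apply/val_inj/funext => i; rewrite /=.
have := ratio_le_bvnorm x i; rewrite x0 normr_le0 mulf_eq0 invr_eq0.
by rewrite pnatr_eq0 orbF => /eqP.
Qed.

HB.instance Definition _ :=
  Lmodule_isNormed.Build K bvspace bvnormD bvnormZ bvnorm0_eq0.

Lemma ratioB (x y : bvspace) i : ratio (x - y) i = ratio x i - ratio y i.
Proof. by rewrite /ratio /= mulrBl. Qed.

Lemma bvspace_cauchy_cvg (F : set_system bvspace) :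
  ProperFilter F -> cauchy F -> cvg F.
Proof.
move=> FF /cauchyP cF.
have cr i : cvg ((fun x : bvspace => ratio x i) @ F).
  apply: scalars_cauchy_cvg; apply/cauchy_exP => e e0.
  have [z Fz] := cF _ e0; exists (ratio z i).
  suff zF : ball z e `<=` (fun x : bvspace => ratio x i) @^-1` ball (ratio z i) e.
    exact: (filterS zF Fz).
  move=> x; rewrite -!ball_normE /= => zx; rewrite -ratioB.
  exact: le_lt_trans (ratio_le_bvnorm _ _) zx.
pose l i : K := lim ((fun x : bvspace => ratio x i) @ F).
pose y : nat -> K := fun i => l i * i.+1%:R.
have ry i : ratio y i = l i by rewrite /ratio /y mulfK// pnatr_eq0.
have rzy z i : ratio (z - y) i = ratio z i - l i.
  by rewrite -ry /ratio /= mulrBl.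
have cvar (z : bvspace) n :
    (fun x : bvspace => series (variation (z - x)) n) @ F -->
    series (variation ((z : nat -> K) - y)) n.
  rewrite /series /=; elim: n => [|n IHn].
    rewrite big_geq//; under eq_cvg do rewrite big_geq//; exact: cvg_cst.
  rewrite big_nat_recr//=; under eq_cvg do rewrite big_nat_recr//=.
  apply: cvgD; first exact: IHn.
  rewrite /variation !rzy; under eq_cvg do rewrite !ratioB.
  by apply: cvg_norm; apply: cvgB; (apply: cvgB; [exact: cvg_cst|exact: cr]).
have near_le (z : bvspace) e : F (ball z e) ->
    forall n, series (variation ((z : nat -> K) - y)) n <= e.
  move=> Fz n; apply: (cvg_lim_le (cvar z n)); apply: filterS Fz => x.
  rewrite -ball_normE /= => /ltW zx.
  exact: le_trans (series_le_bvnorm (z - x) n) zx.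
have near_rle (z : bvspace) e i : F (ball z e) -> `|ratio z i - l i| <= e.
  move=> Fz.
  have c : (fun x : bvspace => `|ratio z i - ratio x i|) @ F --> `|ratio z i - l i|.
    by apply: cvg_norm; apply: cvgB; [exact: cvg_cst|exact: cr].
  apply: (cvg_lim_le c); apply: filterS Fz => x.
  rewrite -ball_normE /= -ratioB => /ltW zx.
  exact: le_trans (ratio_le_bvnorm (z - x) i) zx.
have l0 : l @ \oo --> (0 : K).
  apply/cvgrPdist_lt => /= e e0; have e2 : 0 < e / 2 by rewrite divr_gt0.
  have [z Fz] := cF _ e2.
  have /cvgrPdist_lt/(_ _ e2) := bv_ratio_cvg0 z.
  apply: filterS => n /=; rewrite !sub0r !normrN => zn.
  rewrite -[l n](subKr (ratio z n)) (splitr e).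
  by apply: le_lt_trans (ler_normB _ _) _; rewrite ltr_leD// near_rle.
have rl : ratio y = l by apply/funext.
have [z1 Fz1] := cF _ ltr01.
have zyP : (z1 : nat -> K) - y \in bv_seq.
  apply/bv_seqP; split.
    apply: (@is_cvg_series_bounded _ _ _ 1); last exact: near_le.
    exact: variation_ge0.
  rewrite (_ : ratio _ = (fun i => ratio z1 i - l i)); last exact/funext.
  have := cvgB (bv_ratio_cvg0 z1) l0; rewrite subr0; exact.
have yP : y \in bv_seq.
  by rewrite -[y](subKr (z1 : nat -> K)) rpredB//; exact: valP.
apply: (@cvgP bvspace _ (BVSpace yP)).
apply/cvgrPdist_lt => /= e e0; have e2 : 0 < e / 2 by rewrite divr_gt0.
have [z Fz] := cF _ e2; apply: filterS (Fz) => x; rewrite -ball_normE /= => zx.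
rewrite -(subrKA z) (splitr e); apply: le_lt_trans (ler_normD _ _) _.
rewrite ler_ltD// distrC; apply: bvnorm_le => n; exact: near_le.
Qed.

HB.instance Definition _ := Uniform_isComplete.Build bvspace bvspace_cauchy_cvg.

Definition shift_seq (w : K) x : nat -> K := fun i => w * x i.+1.

Lemma ratio_shift w x i :
  ratio (shift_seq w x) i = w * (ratio x i.+1 * (1 + i.+1%:R^-1)).
Proof.
have n0 : i.+1%:R != 0 :> K by rewrite pnatr_eq0.
have n1 : i.+2%:R != 0 :> K by rewrite pnatr_eq0.
have -> : 1 + i.+1%:R^-1 = i.+2%:R / i.+1%:R :> K.
  by rewrite -[X in X + _](mulfV n0) -[X in _ + X]mul1r -mulrDl natr1.
by rewrite /ratio /shift_seq [_ / _ * _]mulrA divfK// mulrA.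
Qed.

Lemma series_shift_le w (x : bvspace) n :
  series (variation (shift_seq w x)) n <= 3 * `|w| * `|x|.
Proof.
have inv_gt0 i : (0 : K) < i.+1%:R^-1 by rewrite invr_gt0 ltr0n.
have inv_le1 i : (i.+1%:R^-1 : K) <= 1 by rewrite invf_le1 ?ler1n ?ltr0n.
have step i : variation (shift_seq w x) i <=
    `|w| * (2 * variation x i.+1 + `|x| * (i.+1%:R^-1 - i.+2%:R^-1)).
  rewrite /variation !ratio_shift.
  set r1 := ratio x i.+1; set r2 := ratio x i.+2.
  have r1x : `|r1| <= `|x| by exact: ratio_le_bvnorm.
  clearbody r1 r2.
  rewrite [X in `|X| <= _](_ : _ = w * ((r2 - r1) * (1 + i.+2%:R^-1) -
    r1 * (i.+1%:R^-1 - i.+2%:R^-1))); last by ring.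
  rewrite normrM ler_wpM2l//; apply: le_trans (ler_normB _ _) _.
  rewrite !normrM lerD//.
    by rewrite mulrC ler_wpM2r// ger0_norm ?addr_ge0 ?(ltW (inv_gt0 _))// lerD2l.
  rewrite [`|_ - _|]ger0_norm; last first.
    by rewrite subr_ge0 lef_pV2 ?posrE ?ltr0n// ler_nat.
  by rewrite ler_wpM2r ?subr_ge0 ?lef_pV2 ?posrE ?ltr0n ?ler_nat.
apply: (@le_trans _ _ (`|w| * (2 * \sum_(0 <= i < n) variation x i.+1 +
    `|x| * (1 - n.+1%:R^-1)))).
  rewrite /series /=; elim: n => [|n IHn].
    by rewrite !big_geq// invr1 subrr !mulr0 addr0 mulr0.
  rewrite !big_nat_recr//=; apply: le_trans (lerD IHn (step n)) _.
  by rewrite -mulrDr le_eqVlt; apply/orP; left; apply/eqP; ring.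
rewrite [leRHS](_ : _ = `|w| * (2 * `|x| + `|x| * 1)); last by ring.
rewrite ler_wpM2l// lerD//; last by rewrite ler_wpM2l// gerBl ltW.
rewrite ler_wpM2l//; apply: le_trans (series_le_bvnorm x n.+1).
by rewrite /series /= [leRHS]big_nat_recl//= lerDr variation_ge0.
Qed.

Lemma shift_subproof w (x : bvspace) : bv_seq (shift_seq w x).
Proof.
apply/bv_seqP; split.
  apply: is_cvg_series_bounded; last exact: series_shift_le.
  exact: variation_ge0.
apply/norm_cvg0P.
have c : (fun i => `|w| * (`|ratio x (i + 1)%N| * 2)) @ \oo --> (0 : K).
  have -> : (0 : K) = `|w| * (`|0 : K| * 2) by rewrite normr0 mul0r mulr0.
  apply: cvgM; first exact: cvg_cst.
  apply: cvgM; last exact: cvg_cst.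
  by apply: cvg_norm; rewrite (cvg_shiftn 1 (ratio x)); exact: bv_ratio_cvg0.
apply/cvgrPdist_lt => e e0; move/cvgrPdist_lt : c => /(_ e e0).
apply: filterS => i /=; rewrite !sub0r !normrN addn1 => ie.
apply: le_lt_trans ie; rewrite normr_id [leRHS]ger0_norm ?mulr_ge0//.
rewrite ratio_shift; move: (ratio x i.+1) => r.
rewrite !normrM ler_wpM2l// ler_wpM2l//.
rewrite ger0_norm ?addr_ge0 ?invr_ge0// lerD2l.
by rewrite invf_le1 ?ler1n ?ltr0n.
Qed.

Definition wshift (w : K) (x : bvspace) : bvspace :=
  BVSpace (shift_subproof w x).

Lemma shift_is_linear w : linear (wshift w).
Proof.
move=> a x y; apply/val_inj/funext => i.
by rewrite /= /shift_seq /= mulrDr mulrCA.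
Qed.

HB.instance Definition _ w :=
  GRing.isLinear.Build K bvspace bvspace _ (wshift w) (shift_is_linear w).

End SequenceSpace.

(* Operators are everywhere defined, so all the domains D(A^n) and C^oo(A)
   are the whole space. *)
Section Dynamics.
Variables (K : numFieldType) (E : completeNormedModType K).

Definition hypercyclic_vector (A : E -> E) (x : E) : Prop :=
  x != 0 /\ dense (range (fun n => iter n A x)).

Definition hypercyclic (A : E -> E) : Prop := exists x, hypercyclic_vector A x.

Definition periodic_point (A : E -> E) : set E :=
  [set x | exists2 N, (0 < N)%N & iter N A x = x].

Definition chaotic (A : E -> E) : Prop :=
  hypercyclic A /\ dense (periodic_point A).

End Dynamics.

(* For a closed (here, bounded) operator on a Banach space the three parts
   below make up the complement of the resolvent set; see [spectrumE]. *)
Section Spectrum.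
Variables (R : realType) (E : completeNormedModType (scalars R ComplexScalars)).
Implicit Type A : {linear E -> E}.

Definition point_spectrum A : set (scalars R ComplexScalars) :=
  [set l | ~ injective (fun x => A x - l *: x)].

Definition continuous_spectrum A : set (scalars R ComplexScalars) :=
  [set l | let B := fun x => A x - l *: x in
    [/\ injective B, range B <> setT & dense (range B)]].

Definition residual_spectrum A : set (scalars R ComplexScalars) :=
  [set l | let B := fun x => A x - l *: x in
    injective B /\ ~ dense (range B)].

Definition spectrum A : set (scalars R ComplexScalars) :=
  point_spectrum A `|` continuous_spectrum A `|` residual_spectrum A.

Lemma spectrumE A : spectrum A = [set l | ~ bijective (fun x => A x - l *: x)].
Proof.
have surjE (f : E -> E) : range f = setT <-> forall y, exists x, f x = y.
  split=> [fT y|fs].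
    by have : [set: E] y by []; rewrite -fT => -[x _ <-]; exists x.
  by apply/seteqP; split=> // y _; have [x <-] := fs y; exists x.
have bijE (f : E -> E) : bijective f <-> injective f /\ range f = setT.
  split=> [[g fK gK]|[fi /surjE fs]].
    by split; [exact: can_inj fK|apply/surjE => y; exists (g y)].
  have [g gP] := choice fs.
  by exists g => // x; apply: fi; rewrite gP.
apply/seteqP; split=> l /=.
  move=> H /bijE[fi fs]; case: H => [[]|[]]; first by apply.
    by case.
  by move=> _; apply; rewrite fs => O; rewrite setIT.
move=> nb; case: (pselect (injective (fun x => A x - l *: x))) => [fi|]; last first.
  by left; left.
case: (pselect (dense (range (fun x => A x - l *: x)))) => [d|nd].
  by left; right; split=> // fs; apply: nb; exact/bijE.
by right.
Qed.

End Spectrum.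

(* Main.v *)
(* Write [r i = x i / (i + 1)].  Two facts about [X] carry the proof.  First, [X]
   contains, continuously, the weighted l1 space of the sequences [x] such that
   [r] is summable, and finitely supported sequences are dense.  Secondly,
   [|A_w^n| <= |w|^n (2 n + 1)].
   - If [|w| < 1], the powers are summable in norm: orbits are bounded, and for
     [|w| < |l|] the Neumann series inverts [A_w - l].
   - If [1 <= |w|], a hypercyclic vector of [A_w^p] is obtained by placing, at
     sparse positions [n_i], the blocks [v_i / w^(n_i)], where [(v_i)] lists a
     countable dense family of finitely supported sequences, each of them
     infinitely often; the weights [1 / (i + 1)] make the later blocks negligible.
   - If [1 < |w|], periodic extensions of finite sequences, with period [N] and
     multiplier [w^-N], are summable, hence dense periodic points.
   - A sequence such that [x (i + N) = c * x i] with [1 <= |c|] lies in [X] only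
     if it is constant, since otherwise its variation dominates a harmonic
     series.  This excludes chaos for [|w| = 1] and gives the point spectrum.
   - If [|l| = |w|] and [l <> w], cutting the solution of [(A_w - l) x = y] off
     far away shows that the range is dense; the solution for
     [y i = w (l / w)^(i+1) / (i + 2)] grows like the harmonic sums and is never
     in [X]. *)
From Pilot Require Import Defs.
From mathcomp Require Import all_boot all_order all_algebra.
From mathcomp Require Import complex zify ring.
From mathcomp Require Import mathcomp_extra boolp classical_sets functions.
From mathcomp Require Import reals topology normedtype sequences.

Import Order.TTheory GRing.Theory Num.Theory.
Import numFieldNormedType.Exports.
(* [fraction] also exports a [ratio]; make the one of [Defs] prevail. *)
Import Pilot.Defs.

Local Open Scope classical_set_scope.
Local Open Scope complex_scope.
Local Open Scope ring_scope.

Set Implicit Arguments.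
Unset Strict Implicit.
Unset Printing Implicit Defensive.

(** * Density, scalar facts and geometric sums *)

Lemma dense_normP (K : numFieldType) (E : normedModType K) (S : set E) :
  dense S <-> forall (x : E) e, 0 < e -> exists2 y, S y & `|x - y| < e.
Proof.
split=> [dS x e e0|dS O [x Ox] oO].
  have [|y [xy Sy]] := dS (ball x e) _ (ball_open x e).
    by exists x; exact: ballxx.
  by exists y => //; move: xy; rewrite -ball_normE.
have /nbhs_ballP[e /= e0 xeO] : nbhs x O by exact: open_nbhs_nbhs.
have [y Sy xy] := dS x e e0.
by exists y; split=> //; apply: xeO; rewrite -ball_normE.
Qed.

Section ScalarFacts.
Variables (R : realType) (k : scalar_kind).
Notation K := (scalars R k).

Lemma scalars_archi (x : K) : exists n : nat, `|x| <= n%:R.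
Proof.
case: k x => /= x.
  by exists (Num.bound `|x|); rewrite ltW// archi_boundP.
rewrite normc_def; set r := Num.sqrt _.
exists (Num.bound r); rewrite -(rmorph_nat (real_complex R)) lecR ltW//.
by rewrite archi_boundP// sqrtr_ge0.
Qed.

Lemma natr_gt_scalar (x : K) : exists n : nat, forall m, (n <= m)%N -> `|x| < m%:R.
Proof.
have [n xn] := scalars_archi x; exists n.+1 => m nm.
by apply: le_lt_trans xn _; rewrite ltr_nat.
Qed.

Lemma div_natr_lt (x e : K) : 0 <= x -> 0 < e ->
  exists n : nat, forall m, (n <= m)%N -> x / m.+1%:R < e.
Proof.
move=> x0 e0; have [n xn] := natr_gt_scalar (x / e); exists n => m nm.
rewrite ltr_pdivrMr ?ltr0n// mulrC -ltr_pdivrMr//.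
apply: le_lt_trans (xn _ (leqW nm)).
by rewrite ger0_norm// divr_ge0// ltW.
Qed.

Lemma scalars_separable : exists d : nat -> K,
  forall (x e : K), 0 < e -> exists n, `|x - d n| < e.
Proof.
case: k => /=.
  exists (fun n => ratr (odflt 0 (unpickle n))) => x e e0.
  have [|q] := @rat_in_itvoo R (x - e) (x + e).
    by rewrite ltrD2l gtrN.
  rewrite in_itv /= => xq; exists (pickle q); rewrite pickleK /=.
  by rewrite distrC ltr_distl.
exists (fun n => let q : rat * rat := odflt (0, 0) (unpickle n) in
  ((ratr q.1) +i* (ratr q.2))) => x e e0.
have /complex_realP[d ed] : e \is Num.real by exact: gtr0_real.
rewrite ed in e0 *; rewrite (ltcR 0 d) in e0.
have d2 : 0 < d / 2 by rewrite divr_gt0.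
have near_rat (y : R) : exists q : rat, `|y - ratr q| < d / 2.
  have [|q] := @rat_in_itvoo R (y - d / 2) (y + d / 2).
    by rewrite ltrD2l gtrN.
  by rewrite in_itv /= => xq; exists q; rewrite distrC ltr_distl.
have [p xp] := near_rat (complex.Re x); have [q xq] := near_rat (complex.Im x).
exists (pickle (p, q)); rewrite pickleK /=.
rewrite [x - _](_ : _ = (complex.Re x - ratr p)%:C + 'i * (complex.Im x - ratr q)%:C); last first.
  by case: x {xp xq} => c e'; simpc.
apply: le_lt_trans (ler_normD _ _) _.
rewrite normrM [`|'i|](_ : _ = 1) ?mul1r; last first.
  by rewrite normc_def /= expr0n expr1n add0r sqrtr1.
rewrite !normc_def /= !expr0n !addr0 !sqrtr_sqr -rmorphD/= ltcR (splitr d).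
exact: ltrD.
Qed.

End ScalarFacts.

(** The orbit of [0] is reduced to [0] and stays at distance [|e|] from [e], so a dense orbit must
    start at a nonzero vector. *)
Lemma dense_orbit_hypercyclic (K : numFieldType) (E : completeNormedModType K)
    (A : E -> E) (x e : E) :
  A 0 = 0 -> e != 0 -> dense (range (fun n => iter n A x)) ->
  hypercyclic A.
Proof.
move=> A0 e0 dx; exists x; split=> //; apply/eqP => x0.
move/dense_normP : dx => /(_ e `|e|); rewrite normr_gt0 => /(_ e0)[_ [n _ <-]].
rewrite x0 [iter _ _ _](_ : _ = 0) ?subr0 ?ltxx//.
by elim: n => //= n ->.
Qed.

Section GeometricBounds.
Variable K : numFieldType.
Implicit Types r : K.

Lemma sum_geometric_le r n : 0 <= r -> r < 1 ->
  \sum_(0 <= i < n) r ^+ i <= (1 - r)^-1.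
Proof.
move=> r0 r1; rewrite -[leRHS]div1r ler_pdivlMr ?subr_gt0// big_mkord.
by rewrite mulrC -opprB mulNr -subrX1 opprB gerBl exprn_ge0.
Qed.

(** Multiplied by [1 - r], the sum becomes a geometric sum minus [n * r ^ n]. *)
Lemma sum_arith_geometric_le r n : 0 <= r -> r < 1 ->
  \sum_(0 <= i < n) i.+1%:R * r ^+ i <= (1 - r) ^- 2.
Proof.
move=> r0 r1; have s0 : 0 < 1 - r by rewrite subr_gt0.
have id : (1 - r) * (\sum_(0 <= i < n) i.+1%:R * r ^+ i) =
    \sum_(0 <= i < n) r ^+ i - n%:R * r ^+ n.
  elim: n => [|n IHn]; first by rewrite !big_geq// mul0r subrr mulr0.
  by rewrite !big_nat_recr//= mulrDr IHn exprS -natr1; ring.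
rewrite expr2 invfM -(ler_pM2l s0) id mulrA mulfV ?gt_eqF// mul1r.
apply: le_trans (sum_geometric_le n r0 r1).
by rewrite gerBl mulr_ge0// exprn_ge0.
Qed.

End GeometricBounds.

Lemma sum_finsupp_le (K : numDomainType) (f : nat -> K) N n :
  (forall i, 0 <= f i) -> (forall i, (N <= i)%N -> f i = 0) ->
  \sum_(0 <= i < n) f i <= \sum_(0 <= i < N) f i.
Proof.
move=> f0 fN; case: (leqP n N) => [nN|/ltnW Nn].
  by rewrite [leRHS](big_cat_nat (n := n))//= lerDl sumr_ge0.
rewrite (big_cat_nat (n := N))//= [X in _ + X]big_nat_cond [X in _ + X]big1 ?addr0//.
by move=> i /andP[/andP[/fN]].
Qed.

(** * Norm estimates and finitely supported approximation in [X] *)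

Section BVSpace.
Variables (R : realType) (k : scalar_kind).
Notation K := (scalars R k).
Implicit Types (x : nat -> K) (u v : bvspace R k) (w : K).

Lemma variation_le_ratio x i : variation x i <= `|ratio x i.+1| + `|ratio x i|.
Proof. exact: ler_normB. Qed.

(** Each ratio enters at most two consecutive increments, whence the factor 2 in the embedding of
    the weighted l1 space. *)
Lemma series_variation_le x M n :
  (forall m, \sum_(0 <= i < m) `|ratio x i| <= M) ->
  series (variation x) n <= 2 * M.
Proof.
move=> xM; rewrite /series /= mulrC -[2]/(1 + 1) mulrDr mulr1.
apply: (@le_trans _ _ (\sum_(0 <= i < n) `|ratio x i.+1| +
    \sum_(0 <= i < n) `|ratio x i|)).
  by rewrite -big_split /=; apply: ler_sum => i _; exact: variation_le_ratio.
rewrite lerD//; apply: le_trans (xM n.+1).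
by rewrite big_nat_recl//= lerDr.
Qed.

Lemma bv_seq_summable x M :
  (forall n, \sum_(0 <= i < n) `|ratio x i| <= M) -> bv_seq x.
Proof.
move=> xM; apply/bv_seqP; split.
  apply: (@is_cvg_series_bounded _ _ _ (2 * M)); first exact: variation_ge0.
  by move=> n; exact: series_variation_le.
apply/norm_cvg0P; apply: cvg_series_cvg_0.
by apply: (@is_cvg_series_bounded _ _ _ M) => //; exact: normr_ge0.
Qed.

Lemma norm_le_summable u M :
  (forall n, \sum_(0 <= i < n) `|ratio u i| <= M) -> `|u| <= 2 * M.
Proof. by move=> uM; apply: bvnorm_le => n; exact: series_variation_le. Qed.

Lemma bv_seq_finsupp x N : (forall i, (N <= i)%N -> x i = 0) -> bv_seq x.
Proof.
move=> xN; apply: (@bv_seq_summable _ (\sum_(0 <= i < N) `|ratio x i|)) => n.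
by apply: sum_finsupp_le => // i /xN xi; rewrite /ratio xi mul0r normr0.
Qed.

Lemma bv_eq u v : (forall i, u i = v i) -> u = v.
Proof. by move=> uv; apply/val_inj/funext. Qed.

(** Truncation at [N] costs one jump, of size [|ratio u N|], and the tail of the variation series of
    [u]; both tend to zero. *)
Lemma finsupp_approx u (e : K) : 0 < e -> exists N, exists2 v : bvspace R k,
  (forall i, (N <= i)%N -> v i = 0) & `|u - v| < e.
Proof.
move=> e0; have e2 : 0 < e / 2 by rewrite divr_gt0.
have [N [rN SN]] : exists N, `|ratio u N| < e / 2 /\
    `|u| - series (variation u) N < e / 2.
  have /cvgrPdist_lt/(_ _ e2) [N1 _ N1P] := bv_ratio_cvg0 u.
  have su : series (variation u) @ \oo --> `|u| by exact: bv_series_cvg.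
  have /cvgrPdist_lt/(_ _ e2) [N2 _ N2P] := su.
  exists (maxn N1 N2); split.
    by have := N1P _ (leq_maxl N1 N2); rewrite /= sub0r normrN.
  apply: le_lt_trans (N2P _ (leq_maxr N1 N2)).
  by rewrite /= ger0_norm// subr_ge0 series_le_bvnorm.
pose y i := if (i < N)%N then u i else 0.
have yN i : (N <= i)%N -> y i = 0 by move=> Ni; rewrite /y ltnNge Ni.
exists N, (BVSpace (bv_seq_finsupp yN)); first exact: yN.
have ry i : ratio (u - BVSpace (bv_seq_finsupp yN)) i =
    if (i < N)%N then 0 else ratio u i.
  rewrite ratioB /ratio /= /y; case: ifP => _; rewrite ?subrr//.
  by rewrite mul0r subr0.
have H n : series (variation (u - BVSpace (bv_seq_finsupp yN))) n <=
    if (N <= n)%N then `|ratio u N| +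
      (series (variation u) n - series (variation u) N) else 0.
  elim: n => [|n IHn].
    rewrite /series /= big_geq//; case: ifP => //.
    by rewrite leqn0 => /eqP ->; rewrite !big_geq// subrr addr0.
  rewrite seriesEnat /= big_nat_recr//= -/(series _ n).
  rewrite [X in _ + X <= _]/variation !ry.
  (* The new increment lies after, before, or at the jump, in this order. *)
  case: (ltngtP N n.+1) => [|nN|Nn].
  - rewrite ltnS => Nn; rewrite Nn in IHn.
    rewrite [series (variation u) n.+1]big_nat_recr//= -/(series (variation u) n).
    apply: le_trans (lerD IHn (lexx _)) _.
    by rewrite -!addrA !lerD2l [leRHS]addrC.
  - move: IHn; rewrite leqNgt (ltnW nN) /= => IHn.
    by rewrite subrr normr0 addr0.
  - move: IHn; rewrite (_ : (N <= n)%N = false) ?Nn ?ltnn//.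
    by rewrite -Nn subr0 subrr addr0 => IHn; rewrite gerDr.
rewrite (splitr e); apply: le_lt_trans (ltrD rN SN); apply: bvnorm_le => n.
apply: le_trans (H n) _; case: ifP => _.
  by rewrite lerD2l lerD2r series_le_bvnorm.
by rewrite addr_ge0// subr_ge0 series_le_bvnorm.
Qed.

End BVSpace.

(** * Powers of the shift, and the case of modulus less than one *)

Section Shift.
Variables (R : realType) (k : scalar_kind).
Notation K := (scalars R k).
Implicit Types (u v : bvspace R k) (w : K).

Lemma iter_shiftE w n u i : iter n (wshift w) u i = w ^+ n * u (i + n)%N.
Proof.
elim: n i => [|n IHn] i /=; first by rewrite mul1r addn0.
by rewrite /shift_seq IHn exprS mulrA addSnnS.
Qed.

Lemma iter_shift0 w n : iter n (wshift w) 0 = 0.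
Proof. by apply: bv_eq => i; rewrite iter_shiftE mulr0. Qed.

Lemma ratio_iter_shift w n u i : ratio (iter n (wshift w) u) i =
  w ^+ n * (1 + n%:R / i.+1%:R) * ratio u (i + n).
Proof.
have n0 : i.+1%:R != 0 :> K by rewrite pnatr_eq0.
have n1 : (i + n).+1%:R != 0 :> K by rewrite pnatr_eq0.
have -> : 1 + n%:R / i.+1%:R = (i + n).+1%:R / i.+1%:R :> K.
  by rewrite -addSn natrD mulrDl divff.
rewrite /ratio iter_shiftE; move: n0 n1 (w ^+ n) (u _).
move: (i.+1%:R : K) ((i + n).+1%:R : K) => a b a0 b0 c d.
by rewrite -!mulrA; congr (_ * _); rewrite [RHS]mulrC -!mulrA mulVf// mulr1 mulrC.
Qed.

(** A discrete product rule splits each increment in two. As [1 + n / (i + 2) <= n + 1], one part is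
    at most [n + 1] times an increment of [u]; the other is at most [n * |u|] times
    [1 / (i + 1) - 1 / (i + 2)], whose sum telescopes to at most 1. *)
Lemma norm_iter_shift_le w n u :
  `|iter n (wshift w) u| <= `|w| ^+ n * (n.+1%:R + n%:R) * `|u|.
Proof.
have inv_ge0 i : (0 : K) <= i.+1%:R^-1 by rewrite invr_ge0.
have inv_le1 i : (i.+1%:R^-1 : K) <= 1 by rewrite invf_le1 ?ler1n ?ltr0n.
have inv_le i : (i.+2%:R^-1 : K) <= i.+1%:R^-1.
  by rewrite lef_pV2 ?posrE ?ltr0n// ler_nat.
have step i : variation (iter n (wshift w) u) i <= `|w| ^+ n *
    (n.+1%:R * variation u (i + n) +
     n%:R * `|u| * (i.+1%:R^-1 - i.+2%:R^-1)).
  rewrite /variation !ratio_iter_shift addSn.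
  set r1 := ratio u (i + n); set r2 := ratio u (i + n).+1.
  have r1u : `|r1| <= `|u| by exact: ratio_le_bvnorm.
  clearbody r1 r2.
  rewrite [X in `|X| <= _](_ : _ = w ^+ n * ((r2 - r1) * (1 + n%:R / i.+2%:R) -
    n%:R * r1 * (i.+1%:R^-1 - i.+2%:R^-1))); last by ring.
  rewrite normrM normrX ler_wpM2l ?exprn_ge0//; apply: le_trans (ler_normB _ _) _.
  rewrite !normrM lerD//.
    rewrite mulrC ler_wpM2r// ger0_norm ?addr_ge0 ?mulr_ge0//.
    by rewrite -[n.+1%:R]natr1 addrC lerD2r ler_piMr.
  rewrite normr_nat [`|_ - _|]ger0_norm ?subr_ge0//.
  by rewrite ler_wpM2r ?subr_ge0// ler_wpM2l.
apply: bvnorm_le => m.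
have sumle : series (variation (iter n (wshift w) u)) m <= `|w| ^+ n *
    (n.+1%:R * \sum_(0 <= i < m) variation u (i + n) +
     n%:R * `|u| * (1 - m.+1%:R^-1)).
  rewrite /series /=; elim: m => [|m IHm].
    by rewrite !big_geq// invr1 subrr !mulr0 addr0 mulr0.
  rewrite !big_nat_recr//=; apply: le_trans (lerD IHm (step m)) _.
  by rewrite -mulrDr le_eqVlt; apply/orP; left; apply/eqP; ring.
apply: le_trans sumle _; rewrite -[leRHS]mulrA ler_wpM2l ?exprn_ge0// mulrDl lerD//.
  rewrite ler_wpM2l//; apply: le_trans (series_le_bvnorm u (m + n)).
  rewrite /series /= [leRHS](big_cat_nat (n := n)) ?leq_addl//=.
  rewrite [X in _ + X](big_addn 0 (m + n) n) addnK lerDr sumr_ge0// => i _.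
  exact: variation_ge0.
by rewrite ler_piMr ?mulr_ge0// gerBl.
Qed.

Lemma sum_norm_iter_shift_le w u n : `|w| < 1 ->
  \sum_(0 <= i < n) `|iter i (wshift w) u| <= 2 * (1 - `|w|) ^- 2 * `|u|.
Proof.
move=> w1; apply: (@le_trans _ _
    (2 * (\sum_(0 <= i < n) i.+1%:R * `|w| ^+ i) * `|u|)).
  rewrite mulr_sumr mulr_suml; apply: ler_sum => i _.
  apply: le_trans (norm_iter_shift_le w i u) _; rewrite ler_wpM2r//.
  rewrite mulrC mulrA ler_wpM2r ?exprn_ge0// mulrDl mul1r lerD2l ler_nat.
  exact: leqnSn.
by rewrite ler_wpM2r// ler_wpM2l// sum_arith_geometric_le.
Qed.

Lemma shift_bounded_near w :
  bounded_near (wshift w) (nbhs (0 : bvspace R k)).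
Proof.
apply/linear_boundedP; near=> M => u.
apply: (@le_trans _ _ (3 * `|w| * `|u|)).
  by apply: bvnorm_le => n; exact: series_shift_le.
rewrite ler_wpM2r//; near: M; apply: nbhs_pinfty_ge.
by rewrite realM ?realn ?normr_real.
Unshelve. all: by end_near. Qed.

Definition first_unit_seq : nat -> K := fun i => (i == 0%N)%:R.

Lemma first_unit_subproof : bv_seq first_unit_seq.
Proof. by apply: (@bv_seq_finsupp _ _ _ 1) => -[]. Qed.

Definition first_unit : bvspace R k := BVSpace first_unit_subproof.

Lemma first_unit_neq0 : first_unit != 0.
Proof.
apply/eqP => /(congr1 (fun u : bvspace R k => u 0%N))/eqP.
by rewrite /= /first_unit_seq /= oner_eq0.
Qed.

Lemma shift_lt1_not_hypercyclic w : `|w| < 1 -> ~ hypercyclic (wshift w).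
Proof.
move=> w1 [u [_ /dense_normP du]].
(* The orbit has norm at most [M - 1], so it stays at distance at least 1 from the multiple of
   [first_unit] of norm [M]. *)
pose M := 2 * (1 - `|w|) ^- 2 * `|u| + 1.
have M0 : 0 <= M.
  rewrite addr_ge0// !mulr_ge0// invr_ge0 exprn_ge0// subr_ge0.
  exact: ltW.
have e0 : 0 < `|first_unit| by rewrite normr_gt0 first_unit_neq0.
have [_ [n _ <-]] := du ((M / `|first_unit|) *: first_unit) 1 ltr01.
apply/negP; rewrite -real_leNgt ?normr_real ?real1//.
apply: le_trans (lerB_dist _ _).
rewrite normrZ ger0_norm ?divr_ge0// divfK ?gt_eqF// lerBrDl /M lerD2r.
apply: le_trans (sum_norm_iter_shift_le u n.+1 w1).
by rewrite big_nat_recr//= lerDr sumr_ge0.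
Qed.

End Shift.

(** * Divergent variations, periodic points and eigenvalues *)

Section Divergence.
Variables (R : realType) (k : scalar_kind).
Notation K := (scalars R k).
Implicit Types (u v : bvspace R k) (w l c : K) (f x : nat -> K).

(** As for the harmonic series: between [k0 + m N] and [k0 + 2 m N] there are [m] terms of size at
    least [d = c / (k0 + 2 m N + 2)], and [m * d] is at least [e], which does not depend on
    [m >= 1]. This contradicts the Cauchy criterion. *)
Lemma series_dvg_arith f k0 N m0 c : (forall i, 0 <= f i) -> (0 < N)%N ->
  0 < c -> (forall m, (m0 <= m)%N ->
    c <= (k0 + m * N).+2%:R * f (k0 + m * N)%N) ->
  ~ cvgn (series f).
Proof.
move=> f0 N0 c0 cf sf.
pose e := c / (k0 + 2 * N).+2%:R.
have e2 : 0 < e / 2 by rewrite !divr_gt0// ltr0n.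
have /cvgrPdist_lt/(_ _ e2)[n1 _ n1P] := sf.
pose m := maxn (maxn m0 n1) 1.
have m1 : (1 <= m)%N by exact: leq_maxr.
have mm0 : (m0 <= m)%N by rewrite !leq_max leqnn.
have mn1 : (n1 <= m)%N by rewrite !leq_max leqnn orbT.
pose d := c / (k0 + (m + m) * N).+2%:R.
have step t : (t <= m)%N ->
    series f (k0 + m * N)%N + t%:R * d <= series f (k0 + (m + t) * N)%N.
  elim: t => [_|t IHt tm]; first by rewrite mul0r addr0 addn0.
  have -> : (k0 + (m + t.+1) * N = (k0 + (m + t) * N).+1 + N.-1)%N by lia.
  rewrite [leRHS](big_cat_nat (n := (k0 + (m + t) * N).+1)) ?leq_addr//=.
  rewrite big_nat_recr//= -natr1 mulrDl mul1r addrA.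
  apply: (@le_trans _ _ (series f (k0 + (m + t) * N)%N + f (k0 + (m + t) * N)%N)).
    apply: lerD; first exact/IHt/ltnW.
    have := cf (m + t)%N (leq_trans mm0 (leq_addr _ _)).
    rewrite mulrC -ler_pdivrMr ?ltr0n//; apply: le_trans.
    rewrite ler_wpM2l ?(ltW c0)// lef_pV2 ?posrE ?ltr0n// ler_nat.
    by rewrite !ltnS leq_add2l leq_mul2r leq_add2l (ltnW tm) orbT.
  by rewrite lerDl sumr_ge0.
have := step m (leqnn m); apply/negP; rewrite -real_ltNge; last 2 first.
- by rewrite ger0_real// sumr_ge0.
- by rewrite realD ?ger0_real ?mulr_ge0 ?divr_ge0 ?(ltW c0) ?sumr_ge0 ?invr_ge0.
have bn1 : (n1 <= k0 + (m + m) * N)%N by nia.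
have an1 : (n1 <= k0 + m * N)%N by nia.
have ed : e <= m%:R * d.
  rewrite /e /d mulrCA ler_wpM2l ?(ltW c0)//.
  rewrite ler_pdivlMr ?ltr0n// mulrC ler_pdivrMr ?ltr0n// -natrM ler_nat; nia.
apply: (@lt_le_trans _ _ (series f (k0 + m * N)%N + e)); last by rewrite lerD2l.
rewrite -ltrBlDl.
have := ltrD (n1P _ bn1) (n1P _ an1); rewrite -splitr /=.
rewrite [X in X + _ < _]distrC; apply: le_lt_trans.
apply: le_trans (ler_normD _ _); rewrite subrKA.
by rewrite real_ler_norm// realB// ger0_real// sumr_ge0.
Qed.

(** Multiplying the increment of the ratios by [i + 2] gives [x (i + 1) - x i - x i / (i + 1)]. *)
Lemma variation_ge x i :
  `|x i.+1 - x i| - `|x i| / i.+1%:R <= i.+2%:R * variation x i.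
Proof.
have n0 : i.+1%:R != 0 :> K by rewrite pnatr_eq0.
have n1 : i.+2%:R != 0 :> K by rewrite pnatr_eq0.
rewrite -[X in X * variation _ _]normr_nat -normrM mulrBr /ratio.
rewrite [_ * (_ / _)]mulrC divfK// -[i.+2%:R]natr1 mulrDl mul1r.
rewrite [_ * (_ / _)]mulrC divfK// opprD addrA.
by apply: le_trans (lerB_dist _ _); rewrite normrM normfV normr_nat.
Qed.

(* The increments of a nonconstant such [u] are bounded below along an
   arithmetic progression. *)
Lemma quasi_periodic_cst u N c : (0 < N)%N -> 1 <= `|c| ->
  (forall i, u (i + N)%N = c * u i) -> forall i, u i.+1 = u i.
Proof.
move=> N0 c1 uN i; have uM j m : u (j + m * N)%N = c ^+ m * u j.
  elim: m => [|m IHm]; first by rewrite mul0n addn0 mul1r.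
  by rewrite mulSnr addnA uN IHm exprS mulrA.
apply/eqP; rewrite -subr_eq0 -normr_eq0; apply/negP => d0.
have {}d0 : 0 < `|u i.+1 - u i| by rewrite lt_neqAle eq_sym normr_ge0 andbT; apply/negP.
have d2 : 0 < `|u i.+1 - u i| / 2 by rewrite divr_gt0.
(* From [m0] on, the correction [|u i| / (i + m N + 1)] is at most half of the increment, and the
   common factor [|c| ^ m] is at least 1. *)
have [m0 m0P] := div_natr_lt (normr_ge0 (u i)) d2.
apply: (@series_dvg_arith _ i N m0 _ (variation_ge0 u) N0 d2); last first.
  exact: bv_series_cvg.
move=> m mm0; apply: le_trans (variation_ge u _).
rewrite -addSn !uM -mulrBr !normrM -mulrA -mulrBr normrX.
have mi : (m0 <= i + m * N)%N by nia.
have H : `|u i.+1 - u i| / 2 <=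
    `|u i.+1 - u i| - `|u i| / (i + m * N).+1%:R.
  rewrite {2}(splitr `|u i.+1 - u i|) -addrA lerDl subr_ge0.
  exact/ltW/m0P.
rewrite addSn; apply: (le_trans H); rewrite ler_peMl ?exprn_ege1//.
by apply: (le_trans _ H); exact: ltW.
Qed.

(** A periodic [u] satisfies [u (i + N) = w ^- N * u i], hence [u 1 = u 0]. The functional
    [z 0 - z 1 = ratio z 0 - 2 * ratio z 1] has norm at most 3, vanishes at [u] and is 1 at
    [first_unit], so their distance is at least 1/3. *)
Lemma shift_eq1_not_chaotic w : `|w| = 1 ->
  ~ dense (periodic_point (wshift w)).
Proof.
move=> w1 /dense_normP /(_ (first_unit R k) 3^-1).
rewrite invr_gt0 ltr0n => /(_ isT)[u [N N0 uN]].
have w0 : w != 0 by rewrite -normr_eq0 w1 oner_eq0.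
have u10 : u 1%N = u 0%N.
  apply: (@quasi_periodic_cst u N (w ^- N)) => //.
    by rewrite normfV normrX w1 expr1n invr1.
  move=> i; have := iter_shiftE w N u i; rewrite uN => ->.
  by rewrite mulKf// expf_neq0.
apply/negP; rewrite -real_leNgt ?normr_real// ?realV ?realn//.
rewrite -[leLHS]mul1r ler_pdivrMr ?ltr0n//.
rewrite [leLHS](_ : _ =
    `|ratio (first_unit R k - u) 0 - 2 * ratio (first_unit R k - u) 1|); last first.
  rewrite !ratioB /ratio /= /first_unit_seq /= u10 mul0r sub0r divr1.
  by rewrite mulrN [2 * _]mulrC divfK ?pnatr_eq0// opprK divr1 subrK normr1.
apply: le_trans (ler_normB _ _) _; rewrite [X in _ + X]normrM normr_nat.
have -> : 3 = 1 + 2 :> K by rewrite -[2]/(1 + 1) -[3]/(1 + (1 + 1)).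
rewrite mulrDr mulr1 lerD//; first exact: ratio_le_bvnorm.
by rewrite mulrC ler_wpM2r//; exact: ratio_le_bvnorm.
Qed.

(** This is the eigenvector for the eigenvalue [w]. Its ratios are not summable, but its variation
    telescopes. *)
Lemma bv_seq_cst1 : bv_seq (fun=> 1 : K).
Proof.
have n0 i : i.+1%:R != 0 :> K by rewrite pnatr_eq0.
apply/bv_seqP; split.
  apply: (@is_cvg_series_bounded _ _ _ 1); first exact: variation_ge0.
  move=> n; apply: (@le_trans _ _ (1 - n.+1%:R^-1)); last by rewrite gerBl invr_ge0.
  rewrite le_eqVlt; apply/orP; left; apply/eqP.
  rewrite /series /=; elim: n => [|n IHn]; first by rewrite big_geq// invr1 subrr.
  rewrite big_nat_recr//= IHn /variation /ratio !mul1r distrC ger0_norm.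
    by rewrite addrA subrK.
  by rewrite subr_ge0 lef_pV2 ?posrE ?ltr0n// ler_nat.
apply/cvgrPdist_lt => /= e e0; have [m mP] := div_natr_lt (@ler01 K) e0.
exists m => // i /= mi; rewrite sub0r normrN ger0_norm ?divr_ge0//.
exact: mP.
Qed.

(** For [w] nonzero an eigenvector is geometric of ratio [l / w]: summable if [|l| < |w|], and
    otherwise constant by [quasi_periodic_cst] with period 1, which forces [l = w]. *)
Lemma shift_eigenvalueP w l :
  (exists2 u, u != 0 & wshift w u = l *: u) <-> `|l| < `|w| \/ l = w.
Proof.
split=> [[u u0 /(congr1 (@bvspace_seq R k)) wu]|].
  have {}wu i : w * u i.+1 = l * u i by exact: (congr1 (@^~ i) wu).
  have [i ui0] : exists i, u i != 0.
    apply: contrapT => /forallNP H; move/eqP: u0; apply; apply: bv_eq => i.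
    by have /negP := H i; rewrite negbK => /eqP.
  have [w0|w0] := eqVneq w 0.
    right; have /esym/eqP := wu i.
    by rewrite w0 mul0r mulf_eq0 (negPf ui0) orbF => /eqP.
  have [wl|lw] := real_leP (normr_real w) (normr_real l); last by left.
  right; have uc i' : u (i' + 1)%N = l / w * u i'.
    by apply: (mulfI w0); rewrite addn1 wu mulrA [w * _]mulrC divfK.
  have c := quasi_periodic_cst (ltn0Sn 0) _ uc.
  have {}c : u i.+1 = u i.
    by apply: c; rewrite normrM normfV ler_pdivlMr ?normr_gt0// mul1r.
  by apply: (mulIf ui0); rewrite -wu c.
case=> [lw|->].
  have w0 : w != 0 by rewrite -normr_gt0 (le_lt_trans _ lw).
  have r0 : 0 <= `|l / w| by [].
  have r1 : `|l / w| < 1.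
    by rewrite normrM normfV ltr_pdivrMr ?mul1r ?normr_gt0.
  have sP : bv_seq (fun i => (l / w) ^+ i : K).
    apply: (@bv_seq_summable _ _ _ (1 - `|l / w|)^-1) => n.
    apply: le_trans (sum_geometric_le n r0 r1); apply: ler_sum => i _.
    rewrite /ratio normrM normrX ler_piMr ?exprn_ge0//.
    by rewrite normfV normr_nat invf_le1 ?ler1n ?ltr0n.
  exists (BVSpace sP).
    apply/eqP => /(congr1 (fun u : bvspace R k => u 0%N))/eqP.
    by rewrite /= oner_eq0.
  apply: bv_eq => i /=; rewrite /shift_seq /= exprS mulrA.
  by rewrite [w * _]mulrC divfK.
exists (BVSpace bv_seq_cst1); last by apply: bv_eq.
apply/eqP => /(congr1 (fun u : bvspace R k => u 0%N))/eqP.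
by rewrite /= oner_eq0.
Qed.

End Divergence.

(** * The range of [A_w - l] *)

Lemma inv_consecutive (F : numFieldType) n :
  n.+2%:R^-1 / n.+1%:R = n.+1%:R^-1 - n.+2%:R^-1 :> F.
Proof.
have n0 : n.+1%:R != 0 :> F by rewrite pnatr_eq0.
have n1 : n.+1%:R + 1 != 0 :> F by rewrite natr1 pnatr_eq0.
by rewrite -[n.+2%:R]natr1; move: n0 n1; move: (n.+1%:R) => x x0 x1; field; apply/andP.
Qed.

Lemma half_sub_quarters (F : numFieldType) (x : F) : x / 2 = x - x / 4 - x / 4.
Proof. by field. Qed.

Section SpectrumShift.
Variables (R : realType) (k : scalar_kind).
Notation K := (scalars R k).
Implicit Types (u v : bvspace R k) (w l : K).

Lemma normed_series_cvg (E : completeNormedModType K) (f : nat -> E) (M : K) :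
  (forall n, \sum_(0 <= i < n) `|f i| <= M) -> cvgn (series f).
Proof.
move=> fM; have : cvgn (series (fun i => `|f i|)).
  by apply: (@is_cvg_series_bounded _ _ _ M) => // i; exact: normr_ge0.
move=> /cvg_cauchy/cauchy_seriesP cf.
apply/cauchy_cvgP/cauchy_seriesP => e /cf.
apply: filterS => n /=; apply: le_lt_trans.
by rewrite [leRHS]ger0_norm ?sumr_ge0// ler_norm_sum.
Qed.

(** The Neumann series [s] of the powers of [A_(w/l)] applied to [v] converges and satisfies
    [A_(w/l) s = s - v]; thus [- s / l] is a preimage of [v]. *)
Lemma shift_resolvent_surj w l : `|w| < `|l| ->
  forall v, exists u, wshift w u - l *: u = v.
Proof.
move=> wl v; have l0 : l != 0 by rewrite -normr_gt0 (le_lt_trans _ wl).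
have r1 : `|w / l| < 1 by rewrite normrM normfV ltr_pdivrMr ?mul1r ?normr_gt0.
pose f n := iter n (wshift (w / l)) v.
have cf : cvgn (series f).
  apply: normed_series_cvg => n; exact: (sum_norm_iter_shift_le v n r1).
pose s := limn (series f).
have Sf n : wshift (w / l) (series f n) = series f n.+1 - v.
  rewrite /series /= linear_sum big_nat_recl//=.
  by rewrite [v + _]addrC addrK.
have c1 : (fun n => wshift (w / l) (series f n)) @ \oo --> wshift (w / l) s.
  apply: continuous_cvg => //.
  by apply: (linear_bounded_continuous (wshift (w / l))).1; exact: shift_bounded_near.
have c2 : (fun n => wshift (w / l) (series f n)) @ \oo --> s - v.
  under eq_cvg do rewrite Sf.
  apply: cvgB; last exact: cvg_cst.
  have : (fun n => series f (n + 1)%N) @ \oo --> s by rewrite (cvg_shiftn 1 (series f)).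
  by apply: cvg_trans; apply: near_eq_cvg; near=> n; rewrite addn1.
have fs : wshift (w / l) s = s - v.
  exact: (cvg_unique (@norm_hausdorff _ (bvspace R k)) c1 c2).
exists (- l^-1 *: s); apply: bv_eq => i.
have := congr1 (fun u : bvspace R k => u i) fs.
rewrite /= /shift_seq /= => fsi.
rewrite [v i](_ : _ = s i - w / l * s i.+1); last by rewrite fsi subKr.
change (w * (- l^-1 * s i.+1) - l * (- l^-1 * s i) = s i - w / l * s i.+1).
by rewrite !mulNr !mulrN mulrA [l * _]mulrA mulfV// mul1r opprK addrC.
Unshelve. all: by end_near. Qed.

Lemma norm_single_le u M : (forall i, i != M -> u i = 0) ->
  `|u| <= 2 * `|ratio u M|.
Proof.
move=> uM; apply: norm_le_summable => n.
have r0 i : i != M -> `|ratio u i| = 0.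
  by move=> /uM ui; rewrite /ratio ui mul0r normr0.
apply: (@le_trans _ _ (\sum_(0 <= i < M.+1) `|ratio u i|)).
  by apply: sum_finsupp_le => // i Mi; rewrite r0// gtn_eqF.
rewrite big_nat_recr//= big_nat big1 ?add0r// => i /andP[_ iM].
by rewrite r0// ltn_eqF.
Qed.

(** The formal solution of [(A_w - l) x = y] with [x 0 = 0]; it need not lie in [X]. *)
Fixpoint resolvent_seq w l (y : nat -> K) n : K :=
  if n is m.+1 then (y m + l * resolvent_seq w l y m) / w else 0.

(** Past the support of [v] the formal solution does not grow in modulus. Cutting it off after index
    [M] therefore leaves an error at index [M] only, of norm at most [2 |l| |x N| / (M + 1)]. *)
Lemma shift_resolvent_dense w l : w != 0 -> `|l| <= `|w| ->
  dense (range (fun u => wshift w u - l *: u)).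
Proof.
move=> w0 lw; apply/dense_normP => u e e0.
have e2 : 0 < e / 2 by rewrite divr_gt0.
have [N [v vN uv]] := finsupp_approx u e2.
pose x := resolvent_seq w l v.
have xS i : w * x i.+1 = v i + l * x i by rewrite /= mulrC divfK.
have xN i : `|x (N + i)%N| <= `|x N|.
  elim: i => [|i IHi]; first by rewrite addn0.
  apply: le_trans IHi; rewrite -(ler_pM2l (_ : 0 < `|w|)) ?normr_gt0//.
  rewrite -normrM addnS xS vN ?leq_addr// add0r normrM.
  by rewrite ler_wpM2r.
have [m mP] := div_natr_lt (mulr_ge0 (ler0n _ 2) (mulr_ge0 (normr_ge0 l) (normr_ge0 (x N)))) e2.
pose M := (N + m)%N.
pose z i := if (i <= M)%N then x i else 0.
have zP : bv_seq z.
  by apply: (@bv_seq_finsupp _ _ _ M.+1) => i Mi; rewrite /z leqNgt Mi.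
exists (wshift w (BVSpace zP) - l *: BVSpace zP); first by exists (BVSpace zP).
rewrite -(subrKA v) (splitr e); apply: le_lt_trans (ler_normD _ _) _.
rewrite ltrD//.
set d := v - _.
have dE i : d i = v i - (w * z i.+1 - l * z i) by [].
have dM i : i != M -> d i = 0.
  rewrite dE /z neq_ltn => /orP[iM|Mi].
    by rewrite iM ltnW// xS addrK subrr.
  have Ni : (N <= i)%N by apply: leq_trans (ltnW Mi); exact: leq_addr.
  by rewrite ltnNge (ltnW Mi) [(i <= M)%N]leqNgt Mi /= vN// !mulr0 !subrr.
apply: le_lt_trans (norm_single_le dM) _.
apply: le_lt_trans (mP M (leq_addl _ _)).
rewrite /ratio dE /z leqnn ltnn vN ?leq_addr// mulr0 !sub0r opprK.
rewrite !normrM normfV normr_nat -!mulrA ler_wpM2l// ler_wpM2l//.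
by rewrite ler_wpM2r ?invr_ge0//; exact: xN.
Qed.

Lemma half_harmonic_unbounded (B : K) : B \is Num.real -> exists m,
  forall n, (m <= n)%N -> B < \sum_(0 <= i < n) i.+2%:R^-1.
Proof.
move=> rB; have H0 n : (0 : K) <= \sum_(0 <= i < n) i.+2%:R^-1.
  by apply: sumr_ge0 => i _; rewrite invr_ge0.
have [m mB] : exists m, ~ (\sum_(0 <= i < m) i.+2%:R^-1 <= B).
  apply/existsNP => HB.
  apply: (@series_dvg_arith R k (fun i => i.+2%:R^-1) 0 1 0 1) => //.
  - by move=> i; rewrite invr_ge0.
  - by move=> m _; rewrite mulfV// pnatr_eq0.
  - apply: (@is_cvg_series_bounded _ _ _ B) => // i; by rewrite invr_ge0.
exists m => n mn; move/negP : mB; rewrite -real_ltNge ?(ger0_real (H0 _))// => mB.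
apply: (lt_le_trans mB); rewrite [leRHS](big_cat_nat (n := m))//= lerDl.
by apply: sumr_ge0 => i _; rewrite invr_ge0.
Qed.

(* With [c := l / w], a preimage [u] of [(w c^(i+1) / (i+2))_i] satisfies
   [u i = c^i (u 0 + 1/2 + ... + 1/(i+1))], so its increments tend to infinity
   in modulus. *)
Lemma shift_resolvent_not_surj w l : w != 0 -> `|l| = `|w| -> l != w ->
  ~ (forall v, exists u, wshift w u - l *: u = v).
Proof.
move=> w0 lw lDw surj; pose c := l / w.
have c1 : `|c| = 1 by rewrite normrM normfV lw mulfV// normr_eq0.
have d0 : 0 < `|c - 1|.
  by rewrite normr_gt0 subr_eq0; apply: contra lDw => /eqP h; rewrite -(divfK w0 l) -/c h mul1r.
(* The ratios have modulus [|w| / ((i + 1) (i + 2))], and their sum telescopes. *)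
have yP : bv_seq (fun i => w * c ^+ i.+1 / i.+2%:R : K).
  apply: (@bv_seq_summable _ _ _ `|w|) => n.
  apply: (@le_trans _ _ (`|w| * (1 - n.+1%:R^-1))); last first.
    by rewrite ler_piMr// gerBl invr_ge0.
  elim: n => [|n IHn]; first by rewrite big_geq// invr1 subrr mulr0.
  rewrite big_nat_recr//=; apply: le_trans (lerD IHn (lexx _)) _.
  rewrite /ratio !normrM normrX c1 expr1n mulr1 !normfV !normr_nat -mulrA.
  by rewrite -mulrDr ler_wpM2l// inv_consecutive addrA subrK.
have [u uP] := surj (BVSpace yP).
have uS i : u i.+1 = c * u i + c ^+ i.+1 / i.+2%:R.
  have wc : w * c = l by rewrite mulrC divfK.
  apply: (mulfI w0); rewrite mulrDr [w * (c * _)]mulrA wc [w * (_ / _)]mulrA.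
  have := congr1 (fun u : bvspace R k => u i) uP.
  by rewrite /= /shift_seq /GRing.scale /= => /eqP; rewrite subr_eq addrC => /eqP.
have uE i : u i = c ^+ i * (u 0%N + \sum_(0 <= j < i) j.+2%:R^-1).
  elim: i => [|i IHi]; first by rewrite big_geq// addr0 mul1r.
  by rewrite uS IHi big_nat_recr//= exprS; ring.
(* From [m0] on, [|u m| >= 1]; from [m1] on, [1 / (m + 1)] and [1 / (m + 2)] are at most a quarter
   of [|c - 1|], so half of [|c - 1|] remains as a lower bound. *)
have [m0 m0P] := @half_harmonic_unbounded (`|u 0%N| + 1) (realD (normr_real _) (real1 _)).
have d4 : 0 < `|c - 1| / 4 by rewrite divr_gt0.
have [m1 m1P] := div_natr_lt (@ler01 K) d4.
have d2 : 0 < `|c - 1| / 2 by rewrite divr_gt0.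
apply: (@series_dvg_arith R k (variation u) 0 1 (maxn m0 m1) _ (variation_ge0 u) isT d2).
  move=> m; rewrite add0n muln1 geq_max => /andP[mm0 mm1].
  apply: le_trans (variation_ge u m).
  have u1 : 1 <= `|u m|.
    rewrite uE normrM normrX c1 expr1n mul1r addrC.
    apply: le_trans (lerB_normD _ _).
    rewrite lerBrDl [leRHS]ger0_norm; first exact/ltW/m0P.
    by apply: sumr_ge0 => i _; rewrite invr_ge0.
  have i1 : m.+1%:R^-1 <= `|c - 1| / 4 by have /ltW := m1P _ mm1; rewrite div1r.
  have i2 : m.+2%:R^-1 <= `|c - 1| / 4.
    by have /ltW := m1P _ (leqW mm1); rewrite div1r.
  have incr : `|c - 1| * `|u m| - m.+2%:R^-1 <= `|u m.+1 - u m|.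
    rewrite uS [X in _ <= `|X|](_ : _ =
      (c - 1) * u m + c ^+ m.+1 / m.+2%:R) -?normrM; last by ring.
    apply: le_trans (lerB_normD _ _).
    by rewrite [`|_ / _|]normrM normrX c1 expr1n mul1r normfV normr_nat.
  apply: le_trans (lerD incr (lexx _)).
  have h : 1 * (`|c - 1| - m.+1%:R^-1) <= `|u m| * (`|c - 1| - m.+1%:R^-1).
    rewrite ler_wpM2r// subr_ge0; apply: (le_trans i1).
    by rewrite ler_piMr ?(ltW d0)// invf_le1 ?ler1n ?ltr0n.
  rewrite [leRHS](_ : _ = `|u m| * (`|c - 1| - m.+1%:R^-1) - m.+2%:R^-1); last by ring.
  apply: le_trans (lerB h i2); rewrite mul1r.
  apply: le_trans (lerB (lerB (lexx _) i1) (lexx _)).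
  by rewrite half_sub_quarters.
exact: bv_series_cvg.
Qed.

End SpectrumShift.

(** * Auxiliary sums and a countable dense family *)

Section Sums.
Variable K : numFieldType.

Lemma sum_delayed_le (f : nat -> K) D n : (forall i, 0 <= f i) ->
  \sum_(0 <= i < n) (if (D <= i)%N then f (i - D)%N else 0) <=
  \sum_(0 <= i < n) f i.
Proof.
move=> f0; suff -> : \sum_(0 <= i < n) (if (D <= i)%N then f (i - D)%N else 0) =
    \sum_(0 <= i < n - D) f i.
  by rewrite [leRHS](big_cat_nat (n := (n - D)%N)) ?leq_subr//= lerDl sumr_ge0.
elim: n => [|n IHn]; first by rewrite sub0n !big_geq.
rewrite big_nat_recr//= IHn; case: leqP => Dn.
  by rewrite subSn// big_nat_recr.
have /eqP -> : (n.+1 - D == 0)%N by rewrite subn_eq0.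
by have /eqP -> : (n - D == 0)%N; [rewrite subn_eq0 ltnW|rewrite addr0].
Qed.

Lemma sum_half_pow_le j n : \sum_(j.+1 <= i < n) 2 ^- i <= 2 ^- j :> K.
Proof.
have h t : \sum_(j.+1 <= i < j.+1 + t) 2 ^- i = 2 ^- j - 2 ^- (j + t) :> K.
  elim: t => [|t IHt]; first by rewrite !addn0 big_geq// subrr.
  rewrite addnS big_nat_recr ?leq_addr//= IHt addnS addSn exprS.
  have : 2 ^+ (j + t) != 0 :> K by rewrite expf_neq0 ?pnatr_eq0.
  by move: (2 ^- j) (2 ^+ (j + t)) => a b b0; field.
case: (leqP n j.+1) => nj; first by rewrite big_geq// invr_ge0 exprn_ge0.
by rewrite -(subnKC (ltnW nj)) h gerBl invr_ge0 exprn_ge0.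
Qed.

End Sums.

Section Separability.
Variables (R : realType) (k : scalar_kind).
Notation K := (scalars R k).

(** An index encodes a finite list of indices into a countable dense set of scalars; an invalid code
    gives the zero sequence. The support bounds [L] serve to space out the blocks later. *)
Lemma bvspace_separable_finsupp : exists (V : nat -> bvspace R k) (L : nat -> nat),
  (forall m i, (L m <= i)%N -> V m i = 0) /\
  forall (u : bvspace R k) e, 0 < e -> exists m, `|u - V m| < e.
Proof.
have [d dP] := scalars_separable R k.
pose s m : seq nat := odflt [::] (unpickle m).
pose x m i : K := if (i < size (s m))%N then d (nth 0%N (s m) i) else 0.
have xP m i : (size (s m) <= i)%N -> x m i = 0 by rewrite /x leqNgt => /negPf ->.
exists (fun m => BVSpace (bv_seq_finsupp (xP m))), (fun m => size (s m)); split.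
  by move=> m i /xP.
move=> u e e0; have e2 : 0 < e / 2 by rewrite divr_gt0.
have [N [v vN uv]] := finsupp_approx u e2.
(* Errors of [b] in [N] entries give a norm of at most [2 N b]; the successor makes this strictly
   less than [e / 2] and covers [N = 0]. *)
pose b : K := (e / 2) / (2 * N.+1%:R).
have b0 : 0 < b by rewrite divr_gt0// mulr_gt0// ltr0n.
have /choice[c cP] : forall i, exists n, `|v i - d n| < b by move=> i; exact: dP.
exists (pickle (mkseq c N)).
set y := BVSpace _.
have yE i : y i = if (i < N)%N then d (c i) else 0.
  rewrite /y /= /x /s pickleK /= size_mkseq; case: ifP => // iN.
  by rewrite nth_mkseq.
rewrite -(subrKA v) (splitr e); apply: le_lt_trans (ler_normD _ _) _.
rewrite ltrD//.
have /le_lt_trans : `|v - y| <= 2 * (N%:R * b); last apply.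
  apply: norm_le_summable => n.
  have r0 i : (N <= i)%N -> `|ratio (v - y) i| = 0.
    move=> Ni; rewrite ratioB /ratio yE ltnNge Ni vN//= !mul0r subrr.
    by rewrite normr0.
  apply: le_trans (sum_finsupp_le n _ r0) _ => //.
  rewrite mulr_natl -[in leRHS](subn0 N) -sumr_const_nat.
  rewrite big_nat [leRHS]big_nat; apply: ler_sum => i /andP[_ iN].
  rewrite ratioB -mulrBl normrM yE iN normfV normr_nat.
  rewrite -[leRHS]mulr1 ler_pM ?invr_ge0 ?invf_le1 ?ler1n ?ltr0n//.
  exact/ltW/cP.
rewrite [ltRHS](_ : _ = b * (2 * N.+1%:R)); last first.
  by rewrite divfK// mulf_neq0// pnatr_eq0.
by rewrite mulrA mulrC ltr_pM2l// ltr_pM2l// ltr_nat.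
Qed.

End Separability.

(** * A vector built from sparse blocks *)

Section Hypercyclicity.
Variables (R : realType) (k : scalar_kind) (w : scalars R k).
Notation K := (scalars R k).
Hypothesis w1 : 1 <= `|w|.
Variables (v : nat -> nat -> K) (len size : nat -> nat) (n : nat -> nat).
Hypothesis v_finsupp : forall j i, (len j <= i)%N -> v j i = 0.
Hypothesis v_size : forall j, \sum_(0 <= i < len j) `|v j i| <= (size j)%:R.
Hypothesis n0 : n 0 = 0%N.
(** The summand [len j] keeps the blocks disjoint. The last one pushes block [j.+1] so far that,
    even after [n j] shifts, its weights bring its total below [2 ^- j.+1]. *)
Hypothesis n_gap : forall j,
  (n j + len j + 2 ^ j.+1 * (size j.+1).+1 <= n j.+1)%N.

(* Block [i] is a copy of [v i], placed at position [n i] and divided by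
   [w ^+ n i], so that [n i] backward shifts turn it back into [v i]. *)
Definition block_seq : nat -> K := fun a =>
  \sum_(0 <= i < a.+1) (if (n i <= a)%N then w ^- n i * v i (a - n i)%N else 0).

Let n_incr i j : (i < j)%N ->
  (n i + len i <= n j)%N /\ (n i + 2 ^ j * (size j).+1 <= n j)%N.
Proof.
elim: j => // j IHj; rewrite ltnS leq_eqVlt => /orP[/eqP ->|/IHj[]]; have := n_gap j; lia.
Qed.

(** Hence the finite sum in [block_seq] misses no block starting at or before [a]. *)
Let n_ge j : (j <= n j)%N.
Proof.
case: j => // j; have [_] := n_incr (ltn0Sn j); rewrite n0 add0n.
apply: leq_trans; apply: leq_trans (leq_pmulr _ _) => //.
exact/ltnW/ltn_expl.
Qed.

(** After [n j] shifts the earlier blocks are gone and block [j] has become [v j]; only later blocks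
    remain. *)
Let block_diff j a : w ^+ n j * block_seq (a + n j)%N - v j a =
  \sum_(j.+1 <= i < (a + n j).+1) (if (n i <= a + n j)%N then
    w ^+ n j / w ^+ n i * v i (a + n j - n i)%N else 0).
Proof.
have w0 : w != 0 by rewrite -normr_gt0 (lt_le_trans ltr01).
rewrite /block_seq (big_cat_nat (n := j))//=; last first.
  by rewrite leqW// (leq_trans (n_ge j))// leq_addl.
rewrite [X in _ * (X + _)]big_nat [X in _ * (X + _)]big1 ?add0r; last first.
  move=> i /andP[_ /n_incr[ij _]]; case: ifP => // _.
  by rewrite v_finsupp ?mulr0//; lia.
have jn : (j < (a + n j).+1)%N by rewrite ltnS (leq_trans (n_ge j)) ?leq_addl.
rewrite (big_ltn jn) leq_addl addnK.
rewrite mulrDr mulrA mulfV ?expf_neq0// mul1r addrC addKr mulr_sumr.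
by apply: eq_bigr => i _; case: ifP => _; rewrite ?mulr0// mulrA.
Qed.

Let block_tail j m :
  \sum_(0 <= a < m) `|ratio (fun a => w ^+ n j * block_seq (a + n j)%N - v j a) a|
  <= 2 ^- j.
Proof.
pose g i a : K := if (n i <= a + n j)%N then
  `|v i (a + n j - n i)%N| / a.+1%:R else 0.
have g0 i a : 0 <= g i a by rewrite /g; case: ifP => // _; rewrite divr_ge0.
apply: (@le_trans _ _ (\sum_(0 <= a < m) \sum_(j.+1 <= i < m + n j) g i a)).
  rewrite big_nat [leRHS]big_nat; apply: ler_sum => a /andP[_ am].
  rewrite /ratio block_diff normrM normfV normr_nat.
  apply: (@le_trans _ _ (\sum_(j.+1 <= i < (a + n j).+1) g i a)).
    apply: le_trans (ler_wpM2r _ (ler_norm_sum _ _ _)) _; first by rewrite invr_ge0.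
    rewrite mulr_suml big_nat [leRHS]big_nat; apply: ler_sum => i /andP[ji _].
    rewrite /g; case: ifP => _; last by rewrite normr0 mul0r.
    have [_ nij] := n_incr ji; have {}nij : (n j <= n i)%N by lia.
    rewrite normrM ler_wpM2r ?invr_ge0// ler_piMl// normrM normfV !normrX.
    rewrite ler_pdivrMr ?exprn_gt0 ?(lt_le_trans ltr01)// mul1r.
    exact: ler_weXn2l.
  rewrite [leRHS](big_cat_nat (n := (a + n j).+1))/=.
  - by rewrite lerDl sumr_ge0.
  - by rewrite ltnS (leq_trans (n_ge j)) ?leq_addl.
  - by rewrite ltn_add2r.
rewrite exchange_big /=; apply: le_trans (sum_half_pow_le _ j (m + n j)).
rewrite big_nat [leRHS]big_nat; apply: ler_sum => i /andP[ji _].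
have [_ nij] := n_incr ji.
pose C : K := (2 ^ i * (size i).+1)%:R.
have C0 : 0 < C by rewrite ltr0n muln_gt0 expn_gt0.
apply: (@le_trans _ _ (\sum_(0 <= a < m)
    (if (n i - n j <= a)%N then `|v i (a - (n i - n j))%N| else 0) / C)).
  apply: ler_sum => a _; rewrite /g.
  have -> : (n i - n j <= a)%N = (n i <= a + n j)%N by lia.
  case: ifP => ia; last by rewrite mul0r.
  have -> : (a - (n i - n j) = a + n j - n i)%N by lia.
  by rewrite ler_wpM2l// lef_pV2 ?posrE ?C0 ?ltr0n// /C ler_nat; lia.
rewrite -mulr_suml ler_pdivrMr// /C natrM natrX mulKf ?expf_neq0 ?pnatr_eq0//.
have v0 b : 0 <= `|v i b| by [].
apply: le_trans (sum_delayed_le _ _ v0) _.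
apply: le_trans (sum_finsupp_le _ v0 (N := len i) _) _ => [a /v_finsupp ->|].
  by rewrite normr0.
by apply: le_trans (v_size i) _; rewrite ler_nat.
Qed.

Lemma block_approx : exists u : bvspace R k, forall (y : bvspace R k) j,
  (forall i, y i = v j i) -> `|iter (n j) (wshift w) u - y| <= 2 * 2 ^- j.
Proof.
(* Since [n 0 = 0], [block_tail] at [0] bounds [block_seq - v 0], and [v 0] has finite support. *)
have P0 : bv_seq block_seq.
  have d0 : bv_seq (fun a => w ^+ n 0 * block_seq (a + n 0)%N - v 0 a).
    by apply: (@bv_seq_summable _ _ _ (2 ^- 0)) => m; exact: block_tail.
  have v0 : bv_seq (v 0) by apply: bv_seq_finsupp; exact: v_finsupp.
  have := rpredD (d0 : _ \in @bv_seq R k) (v0 : _ \in @bv_seq R k).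
  congr (is_true (bv_seq _)); apply/funext => a.
  change (w ^+ n 0 * block_seq (a + n 0)%N - v 0 a + v 0 a = block_seq a).
  by rewrite n0 mul1r addn0 subrK.
exists (BVSpace P0) => y j yv; apply: norm_le_summable => m.
apply: le_trans (block_tail j m); rewrite le_eqVlt; apply/orP; left.
apply/eqP; apply: eq_bigr => a _; congr (`|_|).
by rewrite ratioB /ratio iter_shiftE -mulrBl yv.
Qed.

End Hypercyclicity.

(** * Hypercyclicity and periodic points of the powers *)

Section Chaos.
Variables (R : realType) (k : scalar_kind).
Notation K := (scalars R k).
Implicit Types (u v : bvspace R k) (w : K).

Lemma shift_power_hypercyclic w p : 1 <= `|w| -> (0 < p)%N ->
  hypercyclic (iter p (wshift w) : bvspace R k -> bvspace R k).
Proof.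
move=> w1 p0; have [V [L [VL Vdense]]] := bvspace_separable_finsupp R k.
(* The exponent of 2 in [j.+1] takes every value infinitely often. *)
pose m j := logn 2 j.+1.
have /choice[s sP] : forall j, exists s : nat,
    \sum_(0 <= i < L (m j)) `|V (m j) i| <= s%:R.
  move=> j; have [s sP] := scalars_archi (\sum_(0 <= i < L (m j)) `|V (m j) i|).
  by exists s; apply: le_trans sP; rewrite real_ler_norm// ger0_real// sumr_ge0.
(* The positions are the multiples [q j * p], so that [q j] iterates of the [p]-th power perform
   exactly that many shifts. *)
pose q := fix q j := if j is i.+1 then
  (q i + (L (m i) + 2 ^ j * (s j).+1))%N else 0%N.
have gap j : (q j * p + L (m j) + 2 ^ j.+1 * (s j.+1).+1 <= q j.+1 * p)%N.
  by rewrite /= mulnDl -addnA leq_add2l leq_pmulr.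
have [x xP] := @block_approx R k w w1 (fun j => V (m j)) (fun j => L (m j)) s
  (fun j => q j * p)%N (fun j => VL (m j)) sP erefl gap.
apply: (@dense_orbit_hypercyclic _ _ _ x (first_unit R k)).
- exact: iter_shift0.
- exact: first_unit_neq0.
apply/dense_normP => u e e0; have e2 : 0 < e / 2 by rewrite divr_gt0.
have [a ua] := Vdense u _ e2.
have [t tP] := div_natr_lt (ler0n K 2) e2.
(* The exponent of 2 in [j.+1] is [a], so block [j] copies [V a], while the power of 3 ensures
   [t <= j] and thus a small error. *)
pose j := (2 ^ a * 3 ^ t).-1.
have jS : j.+1 = (2 ^ a * 3 ^ t)%N by rewrite prednK// muln_gt0 !expn_gt0.
have mj : m j = a.
  by rewrite /m jS lognM ?expn_gt0// pfactorK// lognX (_ : logn 2 3 = 0%N)// muln0 addn0.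
have tj : (t <= j)%N.
  rewrite -ltnS jS (leq_trans (ltn_expl t (isT : 1 < 3)%N))// leq_pmull//.
  by rewrite expn_gt0.
exists (iter (q j) (iter p (wshift w)) x); first by exists (q j).
rewrite -(subrKA (V a)) (splitr e); apply: le_lt_trans (ler_normD _ _) _.
rewrite ltrD// distrC -iterM; apply: (le_lt_trans (xP (V a) j _)).
  by move=> i; rewrite mj.
apply: le_lt_trans (tP j tj).
rewrite ler_wpM2l// lef_pV2 ?posrE ?exprn_gt0 ?ltr0n// -natrX ler_nat.
exact: ltn_expl.
Qed.

(** The exponent is [N] times the number of full periods before [i]: each period is [w ^- N] times
    the previous one, as [iter N (wshift w)] requires of a fixed point. *)
Definition periodic_ext w N u : nat -> K :=
  fun i => w ^- (i - i %% N) * u (i %% N)%N.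

(** The extension of [v] with period [M] agrees with [v] below [M]. Its entries have an absolute sum
    of at most [C], independent of [M], and carry weights of at most [1 / (M + 1)] from [M] on; a
    large [M] makes the error small. *)
Lemma shift_power_periodic_dense w p : 1 < `|w| -> (0 < p)%N ->
  dense (periodic_point (iter p (wshift w) : bvspace R k -> bvspace R k)).
Proof.
move=> w1 p0; apply/dense_normP => u e e0.
have w0 : w != 0 by rewrite -normr_gt0 (lt_trans ltr01).
have e2 : 0 < e / 2 by rewrite divr_gt0.
have [N [v vN uv]] := finsupp_approx u e2.
pose S : K := \sum_(0 <= i < N) `|v i|.
pose r : K := `|w|^-1.
have r0 : 0 <= r by rewrite invr_ge0.
have r1 : r < 1 by rewrite invf_lt1// (lt_trans ltr01).
pose C := S * (1 - r)^-1.
have S0 : 0 <= S by exact: sumr_ge0.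
have C0 : 0 <= C by rewrite mulr_ge0// invr_ge0 subr_ge0 ltW.
have [m mP] := div_natr_lt (mulr_ge0 (ler0n _ 2) C0) e2.
pose M := (N + m).+1.
have NM : (N <= M)%N by rewrite leqW// leq_addr.
pose y := periodic_ext w M v.
have yshift i : y (i + M)%N = w ^- M * y i.
  rewrite /y /periodic_ext modnDr mulrA -invfM -exprD; congr (_ ^- _ * _).
  by rewrite addnBA ?leq_mod// addnC.
have ysmall i : (i < M)%N -> y i = v i.
  by move=> iM; rewrite /y /periodic_ext modn_small// subnn invr1 mul1r.
have ysum n : \sum_(0 <= i < n) `|y i| <= C.
  (* Each period multiplies the sum by [|w| ^- M], which is at most [r] because [M] is positive. *)
  have block b : \sum_(0 <= i < M) `|y (i + b * M)%N| <= S * r ^+ b.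
    elim: b => [|b IHb].
      rewrite mulr1; apply: le_trans (sum_finsupp_le M _ _) => //; last first.
        by move=> i /vN ->; rewrite normr0.
      rewrite big_nat [leRHS]big_nat; apply: ler_sum => i /andP[_ iM].
      by rewrite mul0n addn0 ysmall.
    rewrite exprSr mulrA; apply: le_trans (ler_wpM2r r0 IHb).
    rewrite mulr_suml; apply: ler_sum => i _.
    rewrite mulSnr addnA yshift normrM mulrC ler_wpM2l// normfV normrX /r.
    by rewrite lef_pV2 ?posrE ?exprn_gt0 ?(lt_trans ltr01)// ler_eXnr// ltW.
  apply: (@le_trans _ _ (\sum_(0 <= i < n * M) `|y i|)).
    rewrite [leRHS](big_cat_nat (n := n)) ?leq_pmulr//=.
    by rewrite lerDl sumr_ge0.
  apply: (@le_trans _ _ (S * \sum_(0 <= b < n) r ^+ b)); last first.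
    by rewrite ler_wpM2l// sum_geometric_le.
  elim: n => [|n IHn]; first by rewrite mul0n !big_geq// mulr0.
  rewrite [X in _ <= S * X]big_nat_recr//= mulrDr mulSnr (big_cat_nat (n := (n * M)%N)) ?leq_addr//=.
  rewrite lerD// -[X in \sum_(X <= _ < _) _]add0n big_addn addnC addnK.
  exact: block.
have ratio_le (z : nat -> K) i : `|ratio z i| <= `|z i|.
  rewrite /ratio normrM ler_piMr// normfV normr_nat.
  by rewrite invf_le1 ?ler1n ?ltr0n.
have yP : bv_seq y.
  apply: (@bv_seq_summable _ _ _ C) => n; apply: le_trans (ysum n).
  by apply: ler_sum => i _; exact: ratio_le.
exists (BVSpace yP).
  (* A point fixed by the [M]-th power of the shift is fixed by the [p]-th power of that power. *)
  exists M => //; rewrite -iterM mulnC iterM.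
  have Mfix : iter M (wshift w) (BVSpace yP) = BVSpace yP.
    by apply: bv_eq => i; rewrite iter_shiftE /= yshift mulVKf// expf_neq0.
  by elim: p {p0} => //= p ->.
rewrite -(subrKA v) (splitr e); apply: le_lt_trans (ler_normD _ _) _.
rewrite ltrD// distrC; apply: le_lt_trans (mP M _); last first.
  by rewrite leqW// leq_addl.
rewrite -mulrA; apply: norm_le_summable => n.
apply: le_trans (ler_wpM2r _ (ysum n)); last by rewrite invr_ge0.
rewrite mulr_suml; apply: ler_sum => i _; rewrite ratioB -mulrBl normrM normfV normr_nat.
case: (ltnP i M) => iM.
  by rewrite /= ysmall// subrr normr0 mul0r mulr_ge0 ?invr_ge0.
rewrite vN ?(leq_trans NM)// subr0 ler_wpM2l//.
by rewrite lef_pV2 ?posrE ?ltr0n// ler_nat ltnS.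
Qed.

End Chaos.

Theorem theorem4p1 (R : realType) :
  (forall (k : scalar_kind) (w : scalars R k),
    let A : {linear bvspace R k -> bvspace R k} := wshift w in
    [/\ bounded_near A (nbhs (0 : bvspace R k)),
        `|w| < 1 -> ~ hypercyclic A,
        `|w| = 1 -> hypercyclic A /\ ~ chaotic A
      & 1 < `|w| -> chaotic A /\
          (forall n : nat, (0 < n)%N -> chaotic (iter n A))]) /\
  (forall w : scalars R ComplexScalars,
    let A : {linear bvspace R ComplexScalars -> bvspace R ComplexScalars} :=
      wshift w in
    [/\ spectrum A = [set l | `|l| <= `|w|],
        point_spectrum A = [set l | `|l| < `|w|] `|` [set w]
      & continuous_spectrum A = [set l | `|l| = `|w|] `\ w]).
Proof.
split=> [k w A|w A].
  have chaos n : 1 < `|w| -> (0 < n)%N -> chaotic (iter n A).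
    move=> w1 n0; split; first exact/shift_power_hypercyclic/n0/ltW.
    exact: shift_power_periodic_dense.
  split.
  - exact: shift_bounded_near.
  - exact: shift_lt1_not_hypercyclic.
  - move=> w1; split; last by case=> _; exact: shift_eq1_not_chaotic.
    by apply: (@shift_power_hypercyclic R k w 1) => //; rewrite w1.
  - by move=> w1; split=> [|n n0]; [exact: (chaos 1%N)|exact: chaos].
have injE l : injective (fun x => A x - l *: x) <-> ~ (`|l| < `|w| \/ l = w).
  split=> [li /shift_eigenvalueP[u /eqP u0 wu]|nl x y].
    by apply/u0/li; rewrite linear0 scaler0 subrr [A u]wu subrr.
  move=> /eqP; rewrite -subr_eq0 => /eqP xy; apply/subr0_eq/eqP/negPn/negP => xy0.
  apply: nl; apply/shift_eigenvalueP; exists (x - y) => //.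
  apply/subr0_eq; rewrite [wshift w _]linearB [l *: _]scalerBr -xy !opprB.
  by rewrite addrACA [RHS]addrACA; congr (_ + _); rewrite addrC.
have pE : point_spectrum A = [set l | `|l| < `|w|] `|` [set w].
  apply/seteqP; split=> l /=; rewrite /point_spectrum /=.
    by move=> nl; apply: contrapT => h; apply/nl/injE.
  by move=> h /injE; apply.
have not_surj l : `|l| = `|w| -> l != w ->
    ~ (forall v, exists u, A u - l *: u = v).
  move=> lw lDw; apply: (@shift_resolvent_not_surj R ComplexScalars w l) => //.
  (* If [w] were 0, [|l| = |w|] would force [l = w]. *)
  apply: contra lDw => /eqP w0; move: lw; rewrite w0 normr0 => /eqP.
  by rewrite normr_eq0.
have sE : spectrum A = [set l | `|l| <= `|w|].
  rewrite spectrumE; apply/seteqP; split=> l /=.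
    move=> nb; rewrite real_leNgt ?normr_real//; apply/negP => wl; apply: nb.
    have /choice[g gP] := @shift_resolvent_surj R ComplexScalars w l wl.
    have /injE li : ~ (`|l| < `|w| \/ l = w).
      by case=> lw; move: wl; rewrite ?(lt_gtF lw)// lw ltxx.
    by exists g => // u; apply: li; exact: gP.
  move=> lw [g gK Kg].
  (* An eigenvalue contradicts injectivity; any other [l] of the disc lies on the circle, where
     surjectivity fails. *)
  have [lw'|] := pselect (`|l| < `|w| \/ l = w).
    by have := injE l => -[/(_ (can_inj gK))].
  move=> /not_orP[/negP]; rewrite -real_leNgt ?normr_real// => wl /eqP lDw.
  apply: (not_surj l) => //; first by apply/eqP; rewrite eq_le lw.
  by move=> v; exists (g v); exact: Kg.
split => //.
apply/seteqP; split=> l.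
  move=> lc; have /= lw : [set l | `|l| <= `|w|] l by rewrite -sE; left; right.
  case: lc => /injE/not_orP[/negP]; rewrite -real_leNgt ?normr_real// => wl lDw _ _.
  by split=> //; apply/eqP; rewrite eq_le lw.
move=> [/= lw /eqP lDw]; split.
- by apply/injE => -[|/eqP]; [rewrite lw ltxx|exact/negP].
- move=> rT; apply: (not_surj l) => // v.
  by have : [set: bvspace R ComplexScalars] v by []; rewrite -rT => -[u _ <-]; exists u.
- apply: (@shift_resolvent_dense R ComplexScalars w l); last by rewrite lw.
  apply: contra lDw => /eqP w0; move: lw; rewrite w0 normr0 => /eqP.
  by rewrite normr_eq0.
Qed.
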